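(* (Noether's theorem for optimal control) Let $T=\{\tau(s,\cdot)\}_{s\in P}$, $S=\{\sigma(s,\cdot)\}_{s\in P}$, $U=\{\upsilon(s,\cdot)\}_{s\in P}$, $A=\{\pi(s,\cdot)\}_{s\in P}$ be one parameter groups of diffeomorphisms of sharply open sets $T'\subseteq[t_1,t_2]$, $S'\subseteq H$, $U'\subseteq K$, $A'\subseteq\widetilde{\mathbb R}^d$, respectively. If the augmented functional $$I[q,u,p]=\int_{t_1}^{t_2}\big(\mathcal H(t,q(t),u(t),p(t))-p(t)\cdot\dot q(t)\big)\,dt$$ is invariant under the action of $T,S,U,A$, then the quantity defined for all $q\in\mathcal{GC}^\infty(T',S')$, $u\in\mathcal{GC}^\infty(T',U')$, $p\in\mathcal{GC}^\infty(T',A')$ and $t\in T'$ by $$C(t,q(t),u(t),p(t)):=\mathcal H(t,q(t),u(t),p(t))\,\frac{\partial\tau}{\partial s}(0,t)-p(t)\cdot\frac{\partial\sigma}{\partial s}(0,q(t))$$ is a constant of motion on $T',S',U',A'$; that is, along any weak Pontryagin extremal $(q,u,p)$ such that $q\in\mathcal{GC}^\infty(T',S')$, $u\in\mathcal{GC}^\infty(T',U')$ and $p\in\mathcal{GC}^\infty(T',A')$, one has $\frac{d}{dt}C(t,q(t),u(t),p(t))=0$ for all $t\in T'$.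
   Context: Ring of scalars. Fix a net $\rho=(\rho_\varepsilon)_{\varepsilon\in(0,1]}$ in $(0,1]$ with $\rho_\varepsilon\to0$ as $\varepsilon\to0^+$. ''For $\varepsilon$ small'' means: for all $\varepsilon\in(0,\varepsilon_0]$, for some $\varepsilon_0\in(0,1]$. A net $(x_\varepsilon)\in\mathbb R^{(0,1]}$ is moderate if there is $N\in\mathbb N$ with $|x_\varepsilon|\le\rho_\varepsilon^{-N}$ for $\varepsilon$ small; $(x_\varepsilon)\sim(y_\varepsilon)$ if for all $n\in\mathbb N$, $|x_\varepsilon-y_\varepsilon|\le\rho_\varepsilon^n$ for $\varepsilon$ small. $\widetilde{\mathbb R}$ is the ring of moderate nets modulo $\sim$ with pointwise operations; classes are written $[x_\varepsilon]$, similarly for $\widetilde{\mathbb R}^n$. Order: $x\le y$ iff there are representatives $x=[x_\varepsilon]$, $y=[y_\varepsilon]$ with $x_\varepsilon\le y_\varepsilon$ for all $\varepsilon$; $x<y$ means $x\le y$ and $y-x$ is invertible; $\widetilde{\mathbb R}_{>0}=\{x: x>0\}$. $[a,b]=\{x\in\widetilde{\mathbb R}: a\le x\le b\}$, $(a,b)=\{x: a<x<b\}$, $|[x_\varepsilon]|=[|x_\varepsilon|]$, $B_r(c)=\{x\in\widetilde{\mathbb R}^n:|x-c|<r\}$ for $r\in\widetilde{\mathbb R}_{>0}$, with closure $\overline{B_r(c)}=\{x:|x-c|\le r\}$. The sharp topology on $\widetilde{\mathbb R}^n$ has these balls as a base; all topological notions refer to it. Generalized smooth functions (GSF). For $\Omega_\varepsilon\subseteq\mathbb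 R^n$, $\langle\Omega_\varepsilon\rangle$ is the set of $[x_\varepsilon]\in\widetilde{\mathbb R}^n$ such that for every representative $(x'_\varepsilon)$ one has $x'_\varepsilon\in\Omega_\varepsilon$ for $\varepsilon$ small. For $X\subseteq\widetilde{\mathbb R}^n$, $Y\subseteq\widetilde{\mathbb R}^k$, a map $f:X\to Y$ is a GSF, $f\in\mathcal{GC}^\infty(X,Y)$, if there is a net $f_\varepsilon\in C^\infty(\Omega_\varepsilon,\mathbb R^k)$, $\Omega_\varepsilon\subseteq\mathbb R^n$ open, with $X\subseteq\langle\Omega_\varepsilon\rangle$, $f([x_\varepsilon])=[f_\varepsilon(x_\varepsilon)]\in Y$ and $(\partial^\alpha f_\varepsilon(x_\varepsilon))$ moderate for all $[x_\varepsilon]\in X$ and all multi-indices $\alpha$ (one may always choose $\Omega_\varepsilon=\mathbb R^n$). Derivatives at sharply interior points are $\partial^\alpha f([x_\varepsilon])=[\partial^\alpha f_\varepsilon(x_\varepsilon)]$ (independent of choices), and at boundary points of a set which is the closure of its interior they are the sharp limits from interior points. $\int_c^e f=[\int_{c_\varepsilon}^{e_\varepsilon}f_\varepsilon]$ for $f\in\mathcal{GC}^\infty([a,b],\widetilde{\mathbb R})$, $c,e\in[a,b]$. Functionally compact sets. $K\subseteq\widetilde{\mathbb R}^n$ is functionally compact if $K=[K_\varepsilon]:=\{[x_\varepsilon]: x_\varepsilon\in K_\varepsilon\text{ for }\varepsilon\text{ small}\}$ for compact sets $K_\varepsilon\subseteq\mathbb R^n$ and $K\subseteq B_R(0)$ for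 some $R\in\widetilde{\mathbb R}_{>0}$; it is solid if it is the closure of its sharp interior. For $v\in\mathcal{GC}^\infty([t_1,t_2],\widetilde{\mathbb R}^k)$ defined by $(v_\varepsilon)$: $\|v\|_0=[\max_{1\le i\le k}\max_{t\in[t_{1\varepsilon},t_{2\varepsilon}]}|v^i_\varepsilon(t)|]$. Control setting (standing assumptions). $t_1<t_2$ in $\widetilde{\mathbb R}$; $H\subseteq\widetilde{\mathbb R}^d$, $K\subseteq\widetilde{\mathbb R}^l$ solid functionally compact; $L\in\mathcal{GC}^\infty([t_1,t_2]\times H\times K,\widetilde{\mathbb R})$, $\varphi\in\mathcal{GC}^\infty([t_1,t_2]\times H\times K,\widetilde{\mathbb R}^d)$; $q_1\in\widetilde{\mathbb R}^d$, $r\in\widetilde{\mathbb R}_{>0}$ with $\overline{B_r(q_1)}\subseteq H$. With $M_K:=\max|\varphi(t,q,k)|$ and $L_K:=\max|\partial_q\varphi(t,q,k)|$ over $t_1\le t\le t_2$, $|q-q_1|\le r$, $k\in K$, it is assumed that $(t_2-t_1)M_K\le r$ and $\lim_{n\to+\infty}(t_2-t_1)^nL_K^n=0$. $\mathcal Q:=\{q\in\mathcal{GC}^\infty([t_1,t_2],H):\|q-q_1\|_0\le r\}$, $\mathcal A:=\mathcal{GC}^\infty([t_1,t_2],K)$. Hamiltonian: $\mathcal H(t,q,u,p)=L(t,q,u)+p\cdot\varphi(t,q,u)$ on $[t_1,t_2]\times H\times K\times\widetilde{\mathbb R}^d$. Weak Pontryagin extremal: a triple $(q,u,p)$ with $q\in\mathcal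 Q$, $u\in\mathcal A$, $p\in\mathcal{GC}^\infty([t_1,t_2],\widetilde{\mathbb R}^d)$ such that on $[t_1,t_2]$: $\dot q=\frac{\partial\mathcal H}{\partial p}(t,q,u,p)$, $\dot p=-\frac{\partial\mathcal H}{\partial q}(t,q,u,p)$, $\frac{\partial\mathcal H}{\partial u}(t,q,u,p)=0$, $q(t_1)=q_1$, $p(t_2)=0$. Writing $q\in\mathcal{GC}^\infty(T',S')$ for such $q$ means that the restriction of $q$ to $T'$ takes values in $S'$ (similarly for $u,p$). One parameter groups. For a sharply open $D\subseteq\widetilde{\mathbb R}^k$, $\{\psi(s,\cdot)\}_{s\in P}$ is a one parameter group of diffeomorphisms of $D$ if: $P\subseteq\widetilde{\mathbb R}$ is sharply open, $0\in P$, $\psi\in\mathcal{GC}^\infty(P\times D,D)$; for each $s\in P$ the map $\psi(s,\cdot)\in\mathcal{GC}^\infty(D,D)$ is invertible with $\psi(s,\cdot)^{-1}\in\mathcal{GC}^\infty(D,D)$; $\psi(0,\cdot)=\mathrm{Id}_D$; and $\psi(s,\cdot)\circ\psi(s',\cdot)=\psi(s+s',\cdot)$ whenever $s,s',s+s'\in P$. Invariance. The augmented functional is invariant under the action of $T,S,U,A$ if for any weak Pontryagin extremal $(q,u,p)$ with $q\in\mathcal{GC}^\infty(T',S')$, $u\in\mathcal{GC}^\infty(T',U')$, $p\in\mathcal{GC}^\infty(T',A')$, for all $s\in P$, $t\in T'$: $$\left\{\mathcal H\big(\tau(s,t),\sigma(s,q(t)),\upsilon(s,u(t)),\pi(s,p(t))\big)-\pi(s,p(t))\cdot\frac{d\sigma(s,q(t))}{d\tau(s,t)}\right\}\frac{\partial\tau}{\partial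 t}(s,t)=\mathcal H(t,q(t),u(t),p(t))-p(t)\cdot\dot q(t),$$ where $\frac{d\sigma(s,q(t))}{d\tau(s,t)}:=\partial_t[\sigma(s,q(t))]/\partial_t\tau(s,t)$. *)

(* Defs.v *)
From HB Require Import structures.
From mathcomp Require Import all_boot all_order all_algebra.
From mathcomp Require Import generic_quotient ring_quotient.
From mathcomp Require Import all_classical all_reals all_analysis.

Set Implicit Arguments.
Unset Strict Implicit.
Unset Printing Implicit Defensive.

Import Order.TTheory GRing.Theory Num.Theory.
Import numFieldNormedType.Exports.

Local Open Scope classical_set_scope.
Local Open Scope ring_scope.

(** * The ring of scalars *)

Record epsilon (R : realType) := Epsilon {
  epsval :> R;
  epsilonP : (0 < epsval <= 1) }.

HB.instance Definition _ (R : realType) := [isSub for @epsval R].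
HB.instance Definition _ (R : realType) := [Choice of epsilon R by <:].

Definition epsilon1 (R : realType) : epsilon R :=
  @Epsilon R 1 (introT andP (conj ltr01 (lexx 1))).
HB.instance Definition _ (R : realType) := isPointed.Build (epsilon R) (epsilon1 R).

(* [\forall e \near small R, P e] reads "P e for e small": for all e in (0, e0],
   for some e0 in (0, 1]. *)
Definition small (R : realType) : set_system (epsilon R) :=
  [set P | exists e0 : epsilon R, forall e : epsilon R, (e : R) <= (e0 : R) -> P e].
Arguments small R : clear implicits.

Lemma small_filter (R : realType) : ProperFilter (small R).
Proof.
split; first by case=> e0 /(_ e0 (lexx _)).
split; first by exists point.
- move=> P Q [e1 P1] [e2 Q2]; have [le12|/ltW le21] := leP (e1 : R) (e2 : R).
    exists e1 => e lee; split; first exact: P1.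
    by apply: Q2; exact: le_trans le12.
  exists e2 => e lee; split; last exact: Q2.
  by apply: P1; exact: le_trans le21.
- by move=> P Q PQ [e0 P0]; exists e0 => e /P0 /PQ.
Qed.
#[global] Existing Instance small_filter.

Record gauge (R : realType) := Gauge {
  gauge_fun :> epsilon R -> R;
  gaugeP : forall e, 0 < gauge_fun e <= 1;
  gauge_cvg0 : gauge_fun @ small R --> (0 : R) }.

Section Scalars.
Context {R : realType} (rho : gauge R).
Implicit Types x y : epsilon R -> R.

Definition moderate x : Prop :=
  exists N : nat, \forall e \near small R, `|x e| <= rho e ^- N.

Definition negligible_net x : Prop :=
  forall n : nat, \forall e \near small R, `|x e| <= rho e ^+ n.

Definition moderate_pred : {pred epsilon R -> R} := [pred x | `[< moderate x >]].

Lemma gauge_gt0 e : 0 < rho e. Proof. by have /andP[] := gaugeP rho e. Qed.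
Lemma gauge_le1 e : rho e <= 1. Proof. by have /andP[] := gaugeP rho e. Qed.

Lemma gauge_lt (r : R) : 0 < r -> \forall e \near small R, rho e < r.
Proof.
move=> r0; have /cvgrPdist_lt /(_ r r0) := @gauge_cvg0 _ rho.
apply: filterS => e; rewrite sub0r normrN; exact: le_lt_trans (ler_norm _).
Qed.

Lemma gauge_exprN_le (m n : nat) e : (m <= n)%N -> rho e ^- m <= rho e ^- n.
Proof.
move=> mn; rewrite lef_pV2 ?posrE ?exprn_gt0 ?gauge_gt0 //.
by rewrite ler_wiXn2l ?gauge_le1 // ltW ?gauge_gt0.
Qed.

Lemma moderateB x y : moderate x -> moderate y -> moderate (x - y).
Proof.
move=> [M xM] [N yN]; exists (maxn M N).+1.
near=> e; apply: (le_trans (ler_normB _ _)).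
have xe : `|x e| <= rho e ^- (maxn M N).
  by apply: (le_trans (near xM e _)) => //; rewrite gauge_exprN_le ?leq_maxl.
have ye : `|y e| <= rho e ^- (maxn M N).
  by apply: (le_trans (near yN e _)) => //; rewrite gauge_exprN_le ?leq_maxr.
apply: (le_trans (lerD xe ye)); rewrite exprS invfM -mulr2n -[_ *+ 2]mulr_natl.
rewrite ler_wpM2r ?invr_ge0 ?exprn_ge0 ?ltW ?gauge_gt0 //.
rewrite -[2%:R]invrK ltf_pV2 ?posrE ?invr_gt0 ?gauge_gt0 //.
by near: e; apply: gauge_lt; rewrite invr_gt0.
Unshelve. all: by end_near. Qed.

Lemma moderateM x y : moderate x -> moderate y -> moderate (x * y).
Proof.
move=> [M xM] [N yN]; exists (M + N)%N; near=> e.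
rewrite [(x * y) e]/(x e * y e) normrM exprD invfM.
by apply: ler_pM => //; [apply: (near xM e) | apply: (near yN e)].
Unshelve. all: by end_near. Qed.

Lemma moderate1 : moderate 1.
Proof.
by exists 0%N; apply: nearW => e; rewrite [1 e]/(1 : R) expr0 invr1 normr1.
Qed.

Lemma moderate_subring : subring_closed moderate_pred.
Proof.
split=> [|x y /asboolP xm /asboolP ym|x y /asboolP xm /asboolP ym].
- exact/asboolP/moderate1.
- exact/asboolP/moderateB.
- exact/asboolP/moderateM.
Qed.
HB.instance Definition _ :=
  GRing.isSubringClosed.Build (epsilon R -> R) moderate_pred moderate_subring.

Record moderate_net := ModerateNet {
  net_of :> epsilon R -> R;
  net_ofP : net_of \in moderate_pred }.
HB.instance Definition _ := [isSub for net_of].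
HB.instance Definition _ := [Choice of moderate_net by <:].
HB.instance Definition _ := [SubChoice_isSubComNzRing of moderate_net by <:].

Lemma net_of0 : net_of 0 = 0. Proof. exact: (raddf0 (\val : moderate_net -> _)). Qed.
Lemma net_of1 : net_of 1 = 1. Proof. exact: (rmorph1 (\val : moderate_net -> _)). Qed.
Lemma net_ofMD (a x y : moderate_net) : net_of (a * x + y) = net_of a * net_of x + net_of y.
Proof.
have D := raddfD (\val : moderate_net -> epsilon R -> R) (a * x) y.
have M := rmorphM (\val : moderate_net -> epsilon R -> R) a x.
exact: etrans D (congr1 (+%R^~ _) M).
Qed.

Definition negligible_pred : {pred moderate_net} :=
  [pred x : moderate_net | `[< negligible_net x >]].

Lemma negligible_ideal : idealr_closed negligible_pred.
Proof.
split.
- apply/asboolP => n; apply: nearW => e; rewrite net_of0 normr0.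
  by rewrite exprn_ge0 // ltW ?gauge_gt0.
- apply/negP => /asboolP /(_ 1%N) neg1.
  near (small R) => e.
  have : rho e < 1 by near: e; apply: gauge_lt.
  rewrite ltNge => /negP; apply.
  have : `|net_of (1 : moderate_net) e| <= rho e ^+ 1 by apply: (near neg1 e).
  by rewrite net_of1 [1 e]/(1 : R) normr1 expr1.
- move=> a x y /asboolP nx /asboolP ny; apply/asboolP => n.
  have /asboolP[N aN] := net_ofP a.
  near=> e; rewrite net_ofMD.
  rewrite [X in `|X|]/(net_of a e * net_of x e + net_of y e).
  apply: (le_trans (ler_normD _ _)); rewrite normrM.
  have r0 k : 0 <= rho e ^+ k by rewrite exprn_ge0 // ltW ?gauge_gt0.
  have h1 : `|net_of a e| * `|net_of x e| <= rho e ^- N * rho e ^+ (N + n.+1).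
    by apply: ler_pM => //; [apply: (near aN e) | apply: (near (nx _) e)].
  have h2 : `|net_of y e| <= rho e ^+ n.+1 by apply: (near (ny _) e).
  apply: (le_trans (lerD h1 h2)).
  rewrite exprD mulrA mulVf ?mul1r; last by rewrite gt_eqF // exprn_gt0 ?gauge_gt0.
  rewrite -mulr2n exprS -mulrnAl ler_piMl // -mulr_natl.
  rewrite -ler_pdivlMl // mulr1 ltW //.
  by near: e; apply: gauge_lt; rewrite invr_gt0.
Unshelve. all: by end_near. Qed.
HB.instance Definition _ :=
  isIdealr.Build moderate_net negligible_pred negligible_ideal.

Definition gring : Type := {ideal_quot negligible_pred}.
HB.instance Definition _ := GRing.ComNzRing.on gring.
HB.instance Definition _ := EqQuotient.on gring.

Definition gring_unit : {pred gring} := 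
  [pred x : gring | `[< exists y : gring, y * x = 1 >]].
Definition gring_inv (x : gring) : gring :=
  if x \in gring_unit then xget x [set y : gring | y * x = 1] else x.

Lemma gring_mulVx : {in gring_unit, left_inverse 1 gring_inv *%R}.
Proof.
move=> x xu; rewrite /gring_inv xu; apply: (@xgetPex _ x [set y : gring | y * x = 1]).
exact/asboolP.
Qed.
Lemma gring_unitPl (x y : gring) : y * x = 1 -> gring_unit x.
Proof. by move=> yx; apply/asboolP; exists y. Qed.
Lemma gring_invr_out : {in [predC gring_unit], gring_inv =1 id}.
Proof. by move=> x /negPf xu; rewrite /gring_inv xu. Qed.
HB.instance Definition _ := GRing.ComNzRing_hasMulInverse.Build gring
  gring_mulVx gring_unitPl gring_invr_out.

End Scalars.

Section Classes.
Context {R : realType} {rho : gauge R}.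

(* [cls x_] is the class [x_e]; it is meaningful only for moderate nets (junk
   value 0 otherwise), hence the moderateness clause in [represents]. *)
Definition cls (x_ : epsilon R -> R) : gring rho :=
  \pi_(gring rho)%qT (insubd (0 : moderate_net rho) x_).

Definition represents (x_ : epsilon R -> R) (x : gring rho) : Prop :=
  moderate rho x_ /\ cls x_ = x.

Lemma cls_eqP (x_ y_ : epsilon R -> R) : moderate rho x_ -> moderate rho y_ ->
  cls x_ = cls y_ <-> negligible_net rho (x_ - y_).
Proof.
move=> xm ym; rewrite /cls.
have net_ofB (a b : moderate_net rho) : net_of (a - b) = net_of a - net_of b.
  exact: (raddfB (\val : moderate_net rho -> epsilon R -> R)).
have E : (insubd (0 : moderate_net rho) x_ - insubd (0 : moderate_net rho) y_
            \in @negligible_pred R rho) <-> negligible_net rho (x_ - y_).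
  rewrite -(rwP (asboolP _)) net_ofB.
  by rewrite ![net_of (insubd _ _)]insubdK; [|exact/asboolP..].
rewrite -E; split => [/eqP|h].
  by rewrite eqmodE.
by apply/eqP; rewrite eqmodE.
Qed.

(* Points of R~^n are row vectors over R~, R~ itself being identified with R~^1
   wherever it is the source or the target of a map: a scalar [x] is then the
   1 x 1 matrix [x%:M]. *)
Definition mrepresents m n (x_ : epsilon R -> 'M[R]_(m, n)) (x : 'M[gring rho]_(m, n)) :=
  forall i j, represents (fun e => x_ e i j) (x i j).

Definition mmoderate m n (x_ : epsilon R -> 'M[R]_(m, n)) : Prop :=
  forall i j, moderate rho (fun e => x_ e i j).

Definition gle (x y : gring rho) : Prop :=
  exists x_ y_, [/\ represents x_ x, represents y_ y & forall e, x_ e <= y_ e].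

Definition glt (x y : gring rho) : Prop := gle x y /\ y - x \is a GRing.unit.

Definition mnet m n (A : 'M[gring rho]_(m, n)) (e : epsilon R) : 'M[R]_(m, n) :=
  \matrix_(i, j) net_of (repr (A i j)) e.

(* Euclidean norm (Frobenius norm for matrices); the class does not depend on
   the representatives chosen by [mnet]. *)
Definition vnorm m n (A : 'M[gring rho]_(m, n)) : gring rho :=
  cls (fun e => Num.sqrt (\sum_i \sum_j mnet A e i j ^+ 2)).

(** * Sharp topology *)

Definition gball n (c : 'rV[gring rho]_n) (r : gring rho) : set 'rV[gring rho]_n :=
  [set x | glt (vnorm (x - c)) r].

Definition gcball n (c : 'rV[gring rho]_n) (r : gring rho) : set 'rV[gring rho]_n :=
  [set x | gle (vnorm (x - c)) r].

Definition sharp_interior n (X : set 'rV[gring rho]_n) : set 'rV[gring rho]_n :=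
  [set x | exists2 r, glt 0 r & gball x r `<=` X].

Definition sharp_open n (X : set 'rV[gring rho]_n) : Prop :=
  X `<=` sharp_interior X.

Definition sharp_closure n (X : set 'rV[gring rho]_n) : set 'rV[gring rho]_n :=
  [set x | forall r, glt 0 r -> gball x r `&` X !=set0].

Definition sharp_cvg0 (x_ : nat -> gring rho) : Prop :=
  forall r, glt 0 r -> exists N : nat, forall n, (N <= n)%N ->
    glt (vnorm ((x_ n)%:M : 'rV[gring rho]_1)) r.

Definition gitv (a b : gring rho) : set 'rV[gring rho]_1 :=
  [set t | gle a (t 0 0) /\ gle (t 0 0) b].

Definition prodv m n (X : set 'rV[gring rho]_m) (Y : set 'rV[gring rho]_n) :
    set 'rV[gring rho]_(m + n) :=
  [set x | X (lsubmx x) /\ Y (rsubmx x)].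

Definition internal_set n (K_ : epsilon R -> set 'rV[R]_n) : set 'rV[gring rho]_n :=
  [set x | exists2 x_, mrepresents x_ x & \forall e \near small R, K_ e (x_ e)].

Definition functionally_compact n (K : set 'rV[gring rho]_n) : Prop :=
  (exists2 K_ : epsilon R -> set 'rV[R]_n,
     forall e, compact (K_ e) & K = internal_set K_) /\
  exists2 r, glt 0 r & K `<=` gball 0 r.

Definition solid n (K : set 'rV[gring rho]_n) : Prop :=
  K = sharp_closure (sharp_interior K).

Definition is_gmax n (X : set 'rV[gring rho]_n) (f : 'rV[gring rho]_n -> gring rho)
    (m : gring rho) : Prop :=
  (exists2 x, X x & f x = m) /\ forall x, X x -> gle (f x) m.

(** * Generalized smooth functions *)

(* A multi-index is given as a list of coordinates; [pdiff [:: j1; ...; jm] f]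
   is d_j1 ... d_jm f. *)
Definition pdiff n k (js : seq 'I_n) (f : 'rV[R]_n -> 'rV[R]_k) : 'rV[R]_n -> 'rV[R]_k :=
  foldr (fun j g => 'D_(delta_mx 0 j) g) f js.

Definition smooth_on n k (Om : set 'rV[R]_n) (f : 'rV[R]_n -> 'rV[R]_k) : Prop :=
  forall js x, Om x -> {for x, continuous (pdiff js f)} /\
    forall j, derivable (pdiff js f) x (delta_mx 0 j).

Definition strong_set n (Om : epsilon R -> set 'rV[R]_n) : set 'rV[gring rho]_n :=
  [set x | forall x_, mrepresents x_ x -> \forall e \near small R, Om e (x_ e)].

(* The map f : X -> Y is rendered by a total function of which only the values
   on X matter; [gsf_net X Y f Om f_] says that f is defined by the net f_. *)
Definition gsf_net n k (X : set 'rV[gring rho]_n) (Y : set 'rV[gring rho]_k)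
    (f : 'rV[gring rho]_n -> 'rV[gring rho]_k)
    (Om : epsilon R -> set 'rV[R]_n) (f_ : epsilon R -> 'rV[R]_n -> 'rV[R]_k) : Prop :=
  [/\ forall e, open (Om e),
      forall e, smooth_on (Om e) (f_ e),
      X `<=` strong_set Om &
      forall x x_, X x -> mrepresents x_ x ->
        [/\ Y (f x),
            mrepresents (fun e => f_ e (x_ e)) (f x) &
            forall js, mmoderate (fun e => pdiff js (f_ e) (x_ e))]].

Definition gsf n k (X : set 'rV[gring rho]_n) (Y : set 'rV[gring rho]_k)
    (f : 'rV[gring rho]_n -> 'rV[gring rho]_k) : Prop :=
  exists Om f_, gsf_net X Y f Om f_.

Definition is_pder_int n k (X : set 'rV[gring rho]_n)
    (f : 'rV[gring rho]_n -> 'rV[gring rho]_k) (j : 'I_n)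
    (x : 'rV[gring rho]_n) (y : 'rV[gring rho]_k) : Prop :=
  sharp_interior X x /\
  exists Om f_ x_, [/\ gsf_net X setT f Om f_, mrepresents x_ x &
    mrepresents (fun e => pdiff [:: j] (f_ e) (x_ e)) y].

(* at a point of X outside its interior, the derivative is the sharp limit of
   its values at interior points *)
Definition is_pder_bd n k (X : set 'rV[gring rho]_n)
    (f : 'rV[gring rho]_n -> 'rV[gring rho]_k) (j : 'I_n)
    (x : 'rV[gring rho]_n) (y : 'rV[gring rho]_k) : Prop :=
  [/\ gsf X setT f, X x, ~ sharp_interior X x, sharp_closure (sharp_interior X) x &
      forall r, glt 0 r -> exists2 s, glt 0 s & forall z w, gball x s z ->
        is_pder_int X f j z w -> gball y r w].

(* y is the j-th partial derivative at x of the GSF f defined on X *)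
Definition is_pder n k (X : set 'rV[gring rho]_n)
    (f : 'rV[gring rho]_n -> 'rV[gring rho]_k) (j : 'I_n)
    (x : 'rV[gring rho]_n) (y : 'rV[gring rho]_k) : Prop :=
  is_pder_int X f j x y \/ is_pder_bd X f j x y.

(* That partial derivative as a term, with junk value 0 if it does not exist *)
Definition pder n k (X : set 'rV[gring rho]_n)
    (f : 'rV[gring rho]_n -> 'rV[gring rho]_k) (j : 'I_n)
    (x : 'rV[gring rho]_n) : 'rV[gring rho]_k :=
  xget 0 (is_pder X f j x).

Definition gpartial n m (X : set 'rV[gring rho]_n)
    (f : 'rV[gring rho]_n -> 'rV[gring rho]_1) (idx : 'I_m -> 'I_n)
    (x : 'rV[gring rho]_n) : 'rV[gring rho]_m :=
  \row_i pder X f (idx i) x 0 0.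

Definition gjacobian n m k (X : set 'rV[gring rho]_n)
    (f : 'rV[gring rho]_n -> 'rV[gring rho]_k) (idx : 'I_m -> 'I_n)
    (x : 'rV[gring rho]_n) : 'M[gring rho]_(k, m) :=
  \matrix_(i, j) pder X f (idx j) x 0 i.

(* [m] is the norm ||v||_0 of the GSF v on [t1, t2]; the library norm of a real
   vector is the maximum of the absolute values of its entries, and the supremum
   is a maximum by compactness. *)
Definition is_norm0 k (t1 t2 : gring rho)
    (v : 'rV[gring rho]_1 -> 'rV[gring rho]_k) (m : gring rho) : Prop :=
  exists Om v_ t1_ t2_ m_,
    [/\ gsf_net (gitv t1 t2) setT v Om v_, represents t1_ t1, represents t2_ t2,
        represents m_ m &
        \forall e \near small R, m_ e =
          sup [set `|v_ e (s%:M)| | s in [set s | t1_ e <= s <= t2_ e]]].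

(** * One parameter groups *)

Definition uncurry_mx k k' (psi : 'rV[gring rho]_1 -> 'rV[gring rho]_k -> 'rV[gring rho]_k')
    (x : 'rV[gring rho]_(1 + k)) : 'rV[gring rho]_k' :=
  psi (lsubmx x) (rsubmx x).

Definition one_parameter_group k (P : set 'rV[gring rho]_1) (D : set 'rV[gring rho]_k)
    (psi : 'rV[gring rho]_1 -> 'rV[gring rho]_k -> 'rV[gring rho]_k) : Prop :=
  [/\ [/\ sharp_open P, P 0 & sharp_open D],
      gsf (prodv P D) D (uncurry_mx psi),
      forall s, P s -> gsf D D (psi s) /\
        exists psi', [/\ gsf D D psi', forall x, D x -> psi' (psi s x) = x &
                         forall x, D x -> psi s (psi' x) = x],
      forall x, D x -> psi 0 x = x &
      forall s s', P s -> P s' -> P (s + s') ->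
        forall x, D x -> psi s (psi s' x) = psi (s + s') x].

Definition ds_idx k : 'I_(1 + k) := lshift k ord0.
Definition dt_idx : 'I_(1 + 1) := rshift 1 ord0.

(** * Optimal control *)

Section Control.
Context {d l : nat}.
Variables (t1 t2 : gring rho).
Variables (H : set 'rV[gring rho]_d) (K : set 'rV[gring rho]_l).
Variables (L : 'rV[gring rho]_(1 + d + l) -> 'rV[gring rho]_1).
Variables (phi : 'rV[gring rho]_(1 + d + l) -> 'rV[gring rho]_d).
Variables (q1 : 'rV[gring rho]_d) (r : gring rho).

Definition phase_point (t : 'rV[gring rho]_1) (q : 'rV[gring rho]_d) (u : 'rV[gring rho]_l)
    (p : 'rV[gring rho]_d) : 'rV[gring rho]_(1 + d + l + d) :=
  row_mx (row_mx (row_mx t q) u) p.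

Definition q_idx (i : 'I_d) : 'I_(1 + d + l) := lshift l (rshift 1 i).
Definition u_idx (i : 'I_l) : 'I_(1 + d + l) := rshift (1 + d) i.

(* The dot product of row vectors is p *m v^T *)
Definition hamiltonian (x : 'rV[gring rho]_(1 + d + l + d)) : 'rV[gring rho]_1 :=
  L (lsubmx x) + rsubmx x *m (phi (lsubmx x))^T.

Definition hamiltonian_dom : set 'rV[gring rho]_(1 + d + l + d) :=
  prodv (prodv (prodv (gitv t1 t2) H) K) setT.

Definition trajectories : set ('rV[gring rho]_1 -> 'rV[gring rho]_d) :=
  [set q | gsf (gitv t1 t2) H q /\
     exists2 m, is_norm0 t1 t2 (fun t => q t - q1) m & gle m r].

Definition controls : set ('rV[gring rho]_1 -> 'rV[gring rho]_l) :=
  [set u | gsf (gitv t1 t2) K u].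

Definition weak_extremal (q : 'rV[gring rho]_1 -> 'rV[gring rho]_d)
    (u : 'rV[gring rho]_1 -> 'rV[gring rho]_l)
    (p : 'rV[gring rho]_1 -> 'rV[gring rho]_d) : Prop :=
  [/\ [/\ trajectories q, controls u & gsf (gitv t1 t2) setT p],
      forall t, gitv t1 t2 t ->
        let x := phase_point t (q t) (u t) (p t) in
        [/\ pder (gitv t1 t2) q ord0 t =
              gpartial hamiltonian_dom hamiltonian (fun i => rshift (1 + d + l) i) x,
            pder (gitv t1 t2) p ord0 t =
              - gpartial hamiltonian_dom hamiltonian (fun i => lshift d (q_idx i)) x &
            gpartial hamiltonian_dom hamiltonian (fun i => lshift d (u_idx i)) x = 0],
      q t1%:M = q1 &
      p t2%:M = 0].

Variables (P T' : set 'rV[gring rho]_1) (S' : set 'rV[gring rho]_d)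
  (U' : set 'rV[gring rho]_l) (A' : set 'rV[gring rho]_d).
Variables (tau : 'rV[gring rho]_1 -> 'rV[gring rho]_1 -> 'rV[gring rho]_1)
  (sigma : 'rV[gring rho]_1 -> 'rV[gring rho]_d -> 'rV[gring rho]_d)
  (upsilon : 'rV[gring rho]_1 -> 'rV[gring rho]_l -> 'rV[gring rho]_l)
  (varpi : 'rV[gring rho]_1 -> 'rV[gring rho]_d -> 'rV[gring rho]_d).

Definition extremal_within (q : 'rV[gring rho]_1 -> 'rV[gring rho]_d)
    (u : 'rV[gring rho]_1 -> 'rV[gring rho]_l)
    (p : 'rV[gring rho]_1 -> 'rV[gring rho]_d) : Prop :=
  weak_extremal q u p /\ forall t, T' t -> [/\ S' (q t), U' (u t) & A' (p t)].

Definition dtau_dt (s t : 'rV[gring rho]_1) : 'rV[gring rho]_1 :=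
  pder (prodv P T') (uncurry_mx tau) dt_idx (row_mx s t).

Definition dsigma_dtau (q : 'rV[gring rho]_1 -> 'rV[gring rho]_d)
    (s t : 'rV[gring rho]_1) : 'rV[gring rho]_d :=
  (dtau_dt s t 0 0)^-1 *: pder T' (fun t => sigma s (q t)) ord0 t.

(* Invariance of I[q, u, p] is expressed on the integrand of I alone. *)
Definition augmented_functional_invariant : Prop :=
  forall q u p, extremal_within q u p -> forall s t, P s -> T' t ->
    (hamiltonian (phase_point (tau s t) (sigma s (q t)) (upsilon s (u t)) (varpi s (p t)))
       - varpi s (p t) *m (dsigma_dtau q s t)^T) *m dtau_dt s t
    = hamiltonian (phase_point t (q t) (u t) (p t))
       - p t *m (pder (gitv t1 t2) q ord0 t)^T.

Definition noether_quantity (t : 'rV[gring rho]_1) (q : 'rV[gring rho]_d)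
    (u : 'rV[gring rho]_l) (p : 'rV[gring rho]_d) : 'rV[gring rho]_1 :=
  hamiltonian (phase_point t q u p)
    *m pder (prodv P T') (uncurry_mx tau) (ds_idx 1) (row_mx 0 t)
  - p *m (pder (prodv P S') (uncurry_mx sigma) (ds_idx d) (row_mx 0 q))^T.

(* [is_pder] rather than [pder]: the derivative has to exist, so that the junk
   value 0 of [pder] plays no role. *)
Definition constant_of_motion
    (C : 'rV[gring rho]_1 -> 'rV[gring rho]_d -> 'rV[gring rho]_l ->
         'rV[gring rho]_d -> 'rV[gring rho]_1) : Prop :=
  forall q u p, extremal_within q u p ->
    forall t, T' t -> is_pder T' (fun t => C t (q t) (u t) (p t)) ord0 t 0.

End Control.
End Classes.

(* Main.v *)
From HB Require Import structures.
Require Import Defs.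
From mathcomp Require Import all_boot all_order all_algebra.
From mathcomp Require Import generic_quotient ring_quotient.
From mathcomp Require Import all_classical all_reals all_analysis.
From mathcomp Require Import ring lra.

Set Implicit Arguments.
Unset Strict Implicit.
Unset Printing Implicit Defensive.

Import Order.TTheory GRing.Theory Num.Theory.
Import numFieldNormedType.Exports.

Local Open Scope classical_set_scope.
Local Open Scope ring_scope.

(** Why the theorem holds.

Let (q, u, p) be an extremal, and on the open set P x T' consider
  G(s, t) = H(tau, sigma, upsilon, pi) d_t tau - pi . d_t sigma,
where tau = tau(s, t), sigma = sigma(s, q(t)), upsilon = upsilon(s, u(t)) and
pi = pi(s, p(t)).  Since tau(s, .) is a diffeomorphism, d_t tau is invertible and
G is the integrand of the transformed functional; invariance says that G does not
depend on s.  At s = 0 all the transformations are the identity, d_t tau = 1 and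
d_t sigma = q'; so d_s G = 0 at s = 0 reads
  d_s H + H d_s d_t tau - (d_s pi) . q' - p . d_s d_t sigma = 0,
where d_s H = H_t d_s tau + H_q . d_s sigma + H_u . d_s upsilon + H_p . d_s pi
is (H_t d_s tau) - p' . d_s sigma + q' . d_s pi by the canonical equations.  The
terms in d_s pi cancel.  The same equations give d/dt H(t, q, u, p) = H_t, and with
d_s d_t = d_t d_s what remains is d/dt (H d_s tau - p . d_s sigma) = 0.

All derivatives are taken at sharply interior points, because T', S', U', A' and P
are open, and the argument needs for generalized smooth functions only the rules of
elementary calculus: sums, products, the chain rule and the symmetry of second
derivatives.  A derivative is read off from any net that defines the function, so
these rules are the classical ones applied at each epsilon ([is_derive_chain],
[schwarz]), provided that two facts are known.

First, the derivative does not depend on the net, nor on the representative of the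
point ([derive_represents]).  A net whose values are negligible near a point has
negligible derivatives there ([derive_negligible]): its second derivative is bounded
by a power of 1/rho on a whole segment around the point, since otherwise the worst points,
one for each epsilon, would form a generalized point at which it is not moderate; a
difference quotient with a step that is a large power of rho then gives the result.

Second, the nets obtained by sums, products and composition are again smooth with
moderate derivatives of all orders ([tameD], [tameM], [tame_comp]).

[is_gder] and [vder] package a function with its derivative, the rules of calculus
are proved in this form, and [pder_vder], [vder_is_pder] relate it to [pder] and
[is_pder].  Then [vder_constant] differentiates the invariance and
[noether_identity] is the computation above. *)

(** * Partial derivatives of functions of several real variables *)

Lemma continuous_at_sum (R : realType) (T : topologicalType) I (r : seq I)
    (F : I -> T -> R) (x : T) :
  (forall i, {for x, continuous (F i)}) ->
  {for x, continuous (fun z => \sum_(i <- r) F i z)}.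
Proof.
move=> cF; elim: r => [|i r IH].
  have -> : (fun z => \sum_(i <- [::]) F i z) = cst 0.
    by apply/funext => z; rewrite big_nil.
  exact: cvg_cst.
have -> : (fun z => \sum_(j <- i :: r) F j z) = F i \+ (fun z => \sum_(j <- r) F j z).
  by apply/funext => z; rewrite big_cons.
exact: (continuousD (cF i) IH).
Qed.

Section RowNorm.
Context {R : realType} {n : nat}.
Implicit Types (x : 'rV[R]_n) (r : R).

Lemma row_norm_coord x j : `|x 0 j| <= `|x|.
Proof.
rewrite [leRHS]/Num.Def.normr /= mx_normrE.
exact: (le_bigmax _ (fun ij : 'I_1 * 'I_n => `|x ij.1 ij.2|) (0, j)).
Qed.

Lemma row_norm_le x r : 0 <= r -> (forall j, `|x 0 j| <= r) -> `|x| <= r.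
Proof.
move=> r0 xr; rewrite [leLHS]/Num.Def.normr /= mx_normrE.
by apply: bigmax_le => // -[i j] _ /=; rewrite ord1.
Qed.

Lemma norm_delta_le j : `|delta_mx 0 j : 'rV[R]_n| <= 1.
Proof.
apply: row_norm_le => // k; rewrite mxE eqxx /=.
by case: eqP => _; rewrite ?normr1 ?normr0.
Qed.

End RowNorm.

Section Differentiation.
Context {R : realType} {n : nat}.
Implicit Types (f : 'rV[R]_n -> R) (x y v : 'rV[R]_n).

Lemma is_derive_line f x v (s : R) : derivable f (s *: v + x) v ->
  is_derive s 1 (fun h : R => f (h *: v + x)) ('D_v f (s *: v + x)).
Proof.
have E : (fun h : R => h^-1 *: (f ((h *: 1 + s) *: v + x) - f (s *: v + x))) =
         (fun h : R => h^-1 *: (f (h *: v + (s *: v + x)) - f (s *: v + x))).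
  by apply/funext => h; rewrite [h *: 1]mulr1 scalerDl addrA.
move=> df; split; first by rewrite /derivable /= E.
by rewrite /derive /= E.
Qed.

Lemma line_MVT f x v (h : R) :
  (forall s, `|s| <= `|h| -> derivable f (s *: v + x) v) ->
  exists2 s, `|s| <= `|h| & f (h *: v + x) - f x = h * 'D_v f (s *: v + x).
Proof.
move=> df; pose g (s : R) : R := f (s *: v + x).
have dg s : `|s| <= `|h| -> is_derive s (1:R) (g : R -> R) ('D_v f (s *: v + x)).
  by move=> /df; exact: is_derive_line.
have cg s : `|s| <= `|h| -> {for s, continuous g}.
  move=> /dg gs; apply: differentiable_continuous; apply/derivable1_diffP.
  exact: ex_derive.
have g0 : g 0 = f x by rewrite /g scale0r add0r.
have [h0|h0] := leP 0 h.
  have hs s : s \in `[0, h] -> `|s| <= `|h|.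
    by rewrite in_itv /= => /andP[s0 sh]; rewrite !ger0_norm.
  have [| |s /hs sh] := @MVT_segment _ g (fun s => 'D_v f (s *: v + x)) 0 h h0.
  - by move=> s /subset_itv_oo_cc /hs /dg.
  - apply: continuous_in_subspaceT => s; rewrite inE /= => /hs; exact: cg.
  by rewrite g0 subr0 mulrC => E; exists s.
have hs s : s \in `[h, 0] -> `|s| <= `|h|.
  rewrite in_itv /= => /andP[s0 sh]; rewrite !ler0_norm ?lerN2 //.
  exact: ltW.
have [| |s /hs sh] := @MVT_segment _ g (fun s => 'D_v f (s *: v + x)) h 0 (ltW h0).
- by move=> s /subset_itv_oo_cc /hs /dg.
- apply: continuous_in_subspaceT => s; rewrite inE /= => /hs; exact: cg.
rewrite g0 sub0r => E; exists s => //.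
by rewrite -[LHS]opprB E mulrN opprK mulrC.
Qed.

(** The path from [x] to [y] made of steps along the axes, on each of which the
    mean value theorem in one variable applies. *)
Definition stair y x (k : nat) : 'rV[R]_n :=
  \row_j (if (j < k)%N then y 0 j else x 0 j).

(** Along the stair from [x] to [v + x] the increment of [f] is the sum of the
    [v 0 k * 'D_k f] at points close to [x], and these derivatives are close to
    those at [x]. *)
Lemma C1_is_diff f x :
  (\forall y \near x, forall j, derivable f y (delta_mx 0 j)) ->
  (forall j, {for x, continuous ('D_(delta_mx 0 j) f)}) ->
  is_diff x f (fun v => \sum_j v 0 j * 'D_(delta_mx 0 j) f x).
Proof.
move=> df cf.
pose L (v : 'rV[R]_n) : R := \sum_j v 0 j * 'D_(delta_mx 0 j) f x.
have Ll : linear L.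
  move=> a u v; rewrite /L scaler_sumr -big_split /=; apply: eq_bigr => j _.
  by rewrite !mxE mulrDl -mulrA.
pose LM := GRing.isLinear.Build _ _ _ _ _ Ll.
pose LL : {linear 'rV[R]_n -> R} := HB.pack L LM.
have cL : continuous L.
  move=> v; apply: continuous_at_sum => j.
  apply: (@continuousM _ _ (fun z : 'rV[R]_n => z 0 j) (cst _)).
    exact: coord_continuous.
  exact: cst_continuous.
suff dL : f \o shift x = cst (f x) + LL +o_ (0 : 'rV[R]_n) id.
  have E := diff_unique (cL : continuous LL) dL.
  split; last exact: E.
  apply/diff_locallyP; split; [by rewrite E | by rewrite E].
apply/eqaddoP => eps eps0.
have [r r0 /= rP] : exists2 r : R, 0 < r & forall y, `|y - x| < r ->
    forall j, derivable f y (delta_mx 0 j) /\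
      `|'D_(delta_mx 0 j) f y - 'D_(delta_mx 0 j) f x| <= eps / n.+1%:R.
  have e0 : 0 < eps / n.+1%:R by rewrite divr_gt0.
  have : \forall y \near x, forall j, derivable f y (delta_mx 0 j) /\
      `|'D_(delta_mx 0 j) f y - 'D_(delta_mx 0 j) f x| <= eps / n.+1%:R.
    near=> y => j; split; first by move: j; near: y.
    move: j; near: y; apply: filter_forall => j.
    have /cvgrPdist_le /(_ _ e0) := cf j.
    by apply: filterS => y; rewrite distrC.
  by move=> /nbhs_normP[r r0 rP]; exists r => // y yx; apply: rP; rewrite /= distrC.
suff : \forall v \near (0 : 'rV[R]_n),
  `|(f \o shift x - (cst (f x) + L)) v| <= eps * `|v| by [].
near=> v.
have vr : `|v| < r.
  near: v.
  exact: (@nbhs0_lt R 'rV[R]_n r r0).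
pose S k := stair (v + x) x k.
have S0 : S 0 = x by apply/rowP => j; rewrite mxE.
have Sn : S n = v + x by apply/rowP => j; rewrite mxE ltn_ord.
have step (k : 'I_n) : exists2 y, `|y - x| < r &
    f (S k.+1) - f (S k) = v 0 k * 'D_(delta_mx 0 k) f y.
  have SS : S k.+1 = v 0 k *: delta_mx 0 k + S k.
    apply/rowP => j; rewrite !mxE eqxx /= ltnS leq_eqVlt.
    have [->|/eqP jk] := eqVneq j k; first by rewrite eqxx ltnn mulr1.
    by rewrite (inj_eq val_inj) (introF eqP jk) mulr0 add0r.
  have Sr s : `|s| <= `|v 0 k| -> `|s *: delta_mx 0 k + S k - x| < r.
    move=> sv; apply: le_lt_trans vr; apply: row_norm_le => // j.
    rewrite !mxE eqxx /=.
    have [->|jk] := eqVneq j k.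
      by rewrite ltnn mulr1 addrK (le_trans sv) // row_norm_coord.
    rewrite mulr0 add0r; case: ifP => _; last by rewrite subrr normr0.
    by rewrite addrK row_norm_coord.
  rewrite SS; have [|s /Sr sr ->] := @line_MVT f (S k) (delta_mx 0 k) (v 0 k).
    by move=> s /Sr /rP /(_ k) [].
  by exists (s *: delta_mx 0 k + S k).
have [y yr yE] : exists2 y : 'I_n -> 'rV[R]_n, forall k, `|y k - x| < r &
    forall k : 'I_n, f (S k.+1) - f (S k) = v 0 k * 'D_(delta_mx 0 k) f (y k).
  have : forall k : 'I_n, exists y : 'rV[R]_n, `|y - x| < r /\
    f (S k.+1) - f (S k) = v 0 k * 'D_(delta_mx 0 k) f y.
    by move=> k; have [y ? ?] := step k; exists y.
  by move=> /choice[y yP]; exists y => k; have [] := yP k.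
have -> : (f \o shift x - (cst (f x) + LL)) v =
    \sum_k v 0 k * ('D_(delta_mx 0 k) f (y k) - 'D_(delta_mx 0 k) f x).
  transitivity (f (v + x) - f x - L v); first by rewrite -addrA -opprD.
  rewrite -{1}Sn -{1}S0.
  rewrite -(telescope_sumr (fun k => f (S k)) (leq0n n)) big_mkord /L -sumrB.
  by apply: eq_bigr => k _; rewrite yE mulrBr.
apply: le_trans (ler_norm_sum _ _ _) _.
have B (k : 'I_n) : true -> `|v 0 k * ('D_(delta_mx 0 k) f (y k) - 'D_(delta_mx 0 k) f x)|
    <= `|v| * (eps / n.+1%:R).
  move=> _; rewrite normrM ler_pM // ?row_norm_coord //.
  by have [] := rP _ (yr k) k.
apply: le_trans (ler_sum _ B) _; rewrite sumr_const card_ord.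
rewrite -mulrnAr mulrC ler_wpM2r // -[_ *+ n]mulr_natr -mulrA ler_piMr ?ltW //.
by rewrite mulrC ltr_pdivrMr // mul1r ltr_nat.
Unshelve. all: by end_near. Qed.

End Differentiation.

Lemma derive_line0 (R : realType) (V W : normedModType R) (f : V -> W) (x v : V) :
  'D_v f x = 'D_(1 : R) (fun h : R => f (h *: v + x)) 0.
Proof.
have E : (fun h : R => h^-1 *: (f ((h *: (1 : R) + 0 : R) *: v + x) - f ((0 : R) *: v + x))) =
         (fun h : R => h^-1 *: (f (h *: v + x) - f x)).
  by apply/funext => h; rewrite [h *: 1]mulr1 addr0 scale0r add0r.
by rewrite /derive /= E.
Qed.

(** The restriction of [g] to the line through [x] is differentiable, and [f] is
    differentiable at [g x] because its partial derivatives are continuous. *)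
Lemma is_derive_chain (R : realType) n k (f : 'rV[R]_k -> R)
    (g : 'rV[R]_n -> 'rV[R]_k) (x v : 'rV[R]_n) :
  (forall i, derivable (fun z => g z 0 i) x v) ->
  (\forall y \near g x, forall i, derivable f y (delta_mx 0 i)) ->
  (forall i, {for g x, continuous ('D_(delta_mx 0 i) f)}) ->
  is_derive x v (fun z => f (g z))
    (\sum_i 'D_(delta_mx 0 i) f (g x) * 'D_v (fun z => g z 0 i) x).
Proof.
move=> dg df cf; have dfx := C1_is_diff df cf.
have dgx : derivable g x v by apply/derivable_mxP => i j; rewrite ord1.
pose G (h : R) := g (h *: v + x).
have G0 : G 0 = g x by rewrite /G scale0r add0r.
have dG : differentiable G (0 : R).
  by apply/derivable1_diffP; have /derivable1P := dgx.
have df0 : differentiable f (G 0) by rewrite G0; exact: ex_diff.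
have dfG : differentiable (f \o G) (0 : R) by exact: differentiable_comp.
split; first by apply/derivable1P; apply/derivable1_diffP.
rewrite derive_line0 (deriveE _ dfG) diff_comp //= G0 diff_val -(deriveE _ dG).
rewrite -derive_line0 derive_mx //.
by apply: eq_bigr => i _; rewrite mxE mulrC.
Qed.

Section Schwarz.
Context {R : realType} {n : nat} (f : 'rV[R]_n -> R) (x : 'rV[R]_n) (r : R).
Local Notation e_ j := (delta_mx 0 j : 'rV[R]_n).

(** The mean value theorem is applied first along [i] to the increment of [f] in
    the direction [j], then along [j]; the left-hand side is symmetric in [i], [j]. *)
Lemma second_difference (i j : 'I_n) (h : R) : 0 < h -> h *+ 2 < r ->
  (forall y, `|y - x| < r -> derivable f y (e_ i) /\
     derivable ('D_(e_ i) f) y (e_ j)) ->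
  exists2 y, `|y - x| <= h *+ 2 &
    f (h *: e_ j + (h *: e_ i + x)) - f (h *: e_ j + x) - f (h *: e_ i + x) + f x
    = h * (h * 'D_(e_ j) ('D_(e_ i) f) y).
Proof.
move=> h0 hr df; pose g z := f (h *: e_ j + z) - f z.
have B s s' : `|s| <= h -> `|s'| <= h -> `|s' *: e_ j + (s *: e_ i + x) - x| <= h *+ 2.
  move=> sh sh'; rewrite addrA addrK mulr2n.
  apply: le_trans (ler_normD _ _) _; apply: lerD.
    by rewrite normrZ -[leRHS]mulr1 ler_pM // norm_delta_le.
  by rewrite normrZ -[leRHS]mulr1 ler_pM // norm_delta_le.
have h_h : `|h| <= h by rewrite gtr0_norm.
have dshE s : (fun h' : R => h'^-1 *: (f (h *: e_ j + (h' *: e_ i + (s *: e_ i + x))) - f (h *: e_ j + (s *: e_ i + x))))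
    = (fun h' : R => h'^-1 *: (f (h' *: e_ i + (h *: e_ j + (s *: e_ i + x))) - f (h *: e_ j + (s *: e_ i + x)))).
  by apply/funext => h'; rewrite (addrCA (h *: _)).
have dsh s : `|s| <= h -> derivable (fun z => f (h *: e_ j + z)) (s *: e_ i + x) (e_ i).
  move=> sh; have [+ _] := df _ (le_lt_trans (B s h sh h_h) hr).
  by rewrite /derivable /= (dshE s).
have Dsh s : 'D_(e_ i) (fun z => f (h *: e_ j + z)) (s *: e_ i + x)
    = 'D_(e_ i) f (h *: e_ j + (s *: e_ i + x)).
  by rewrite /derive /= (dshE s).
have d0 s : `|s| <= h -> derivable f (s *: e_ i + x) (e_ i).
  move=> sh; have := B s 0 sh; rewrite normr0 scale0r add0r => /(_ (ltW h0)) b.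
  by have [] := df _ (le_lt_trans b hr).
have [s|s sh gE] := @line_MVT R n g x (e_ i) h.
  rewrite (gtr0_norm h0) => sh; apply: derivableB; [exact: dsh | exact: d0].
rewrite (gtr0_norm h0) in sh.
have [s'|s' sh' DE] := @line_MVT R n ('D_(e_ i) f) (s *: e_ i + x) (e_ j) h.
  by rewrite (gtr0_norm h0) => sh'; have [] := df _ (le_lt_trans (B s s' sh sh') hr).
rewrite (gtr0_norm h0) in sh'.
exists (s' *: e_ j + (s *: e_ i + x)); first exact: B.
rewrite -DE -Dsh -deriveB; [|exact: dsh|exact: d0].
have -> : 'D_(e_ i) ((fun z => f (h *: e_ j + z)) - f) (s *: e_ i + x) =
  'D_(e_ i) g (s *: e_ i + x) by [].
by rewrite -gE /g; ring.
Qed.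

End Schwarz.

Lemma near_ballP (R : realType) n (P : 'rV[R]_n -> Prop) (x : 'rV[R]_n) :
  (\forall y \near x, P y) -> exists2 r : R, 0 < r & forall y, `|y - x| < r -> P y.
Proof.
move=> /nbhs_normP[r r0 rP]; exists r => // y yx.
by have := rP y; apply; rewrite /= distrC.
Qed.

(** The points [y] and [z] need not coincide: continuity of both functions brings
    the common value back to [x]. *)
Lemma eq_at_limit (R : realType) n (g g' : 'rV[R]_n -> R) (x : 'rV[R]_n) :
  {for x, continuous g} -> {for x, continuous g'} ->
  (forall r : R, 0 < r -> exists y z, [/\ `|y - x| < r, `|z - x| < r & g y = g' z]) ->
  g x = g' x.
Proof.
have near_g (u : 'rV[R]_n -> R) e : {for x, continuous u} -> 0 < e ->
    exists2 r : R, 0 < r & forall y, `|y - x| < r -> `|u x - u y| < e.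
  move=> cu e0; have /cvgrPdist_lt /(_ e e0) := cu.
  exact: near_ballP.
move=> cg cg' yz; apply/eqP; rewrite -subr_eq0 -normr_le0; apply/ler_addgt0Pl => e e0.
have e2 : 0 < e / 2 by rewrite divr_gt0.
have [r r0 rP] := near_g g _ cg e2; have [r' r'0 r'P] := near_g g' _ cg' e2.
have [|y [z [yr zr E]]] := yz (Num.min r r'); first by rewrite lt_min r0.
rewrite addr0 -(subrKA (g y)) {2}E (splitr e); apply: le_trans (ler_normD _ _) _.
apply: lerD; first by apply/ltW/rP; rewrite (lt_le_trans yr) // ge_min lexx.
by rewrite distrC; apply/ltW/r'P; rewrite (lt_le_trans zr) // ge_min lexx orbT.
Qed.

(** Near [x] the two mixed derivatives take a common value, namely the second
    difference quotient, at points that may differ. *)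
Lemma schwarz (R : realType) n (f : 'rV[R]_n -> R) (x : 'rV[R]_n) (i j : 'I_n) :
  (\forall y \near x, forall k, derivable f y (delta_mx 0 k) /\
     forall m, derivable ('D_(delta_mx 0 k) f) y (delta_mx 0 m)) ->
  (forall k m, {for x, continuous ('D_(delta_mx 0 m) ('D_(delta_mx 0 k) f))}) ->
  'D_(delta_mx 0 j) ('D_(delta_mx 0 i) f) x = 'D_(delta_mx 0 i) ('D_(delta_mx 0 j) f) x.
Proof.
move=> /near_ballP[r r0 df] cf; apply: (@eq_at_limit _ _ ('D_(delta_mx 0 j) ('D_(delta_mx 0 i) f))
  ('D_(delta_mx 0 i) ('D_(delta_mx 0 j) f))); [exact: cf | exact: cf |].
move=> r' r'0; set s := Num.min r r'.
have s0 : 0 < s by rewrite lt_min r0.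
have h0 : 0 < s / 4 by rewrite divr_gt0.
have hs : (s / 4) *+ 2 < s by rewrite -mulr_natr; lra.
have D k m y : `|y - x| < s -> derivable f y (delta_mx 0 k) /\
    derivable ('D_(delta_mx 0 k) f) y (delta_mx 0 m).
  move=> ys; have yr : `|y - x| < r by rewrite (lt_le_trans ys) // ge_min lexx.
  by have [d dd] := df y yr k; split; [exact: d | exact: dd].
have [y yh yE] := second_difference h0 hs (D i j).
have [z zh zE] := second_difference h0 hs (D j i).
have sr : s <= r' by rewrite ge_min lexx orbT.
exists y, z; split; [by rewrite (le_lt_trans yh) // (lt_le_trans hs)
  | by rewrite (le_lt_trans zh) // (lt_le_trans hs) |].
apply: (mulfI (lt0r_neq0 h0)); apply: (mulfI (lt0r_neq0 h0)).
apply: etrans (esym yE) _; apply: etrans zE.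
by congr (_ + _); rewrite addrAC addrCA.
Qed.

(** * Smoothness of vector valued functions, component by component *)

Definition spdiff (R : realType) n (js : seq 'I_n) (f : 'rV[R]_n -> R) : 'rV[R]_n -> R :=
  foldr (fun j g => 'D_(delta_mx 0 j) g) f js.

Lemma row_continuous (R : realType) (T : topologicalType) k (f : T -> 'rV[R]_k) x :
  (forall i, {for x, continuous (fun z => f z 0 i)}) -> {for x, continuous f}.
Proof.
move=> cf; apply/cvgrPdist_le => e e0.
have : \forall y \near x, forall i, `|f x 0 i - f y 0 i| <= e.
  apply: (@filter_forall _ _ (fun i y => `|f x 0 i - f y 0 i| <= e)) => i.
  by have /cvgrPdist_le := cf i; exact.
apply: filterS => y fy; apply: row_norm_le; first exact: ltW.
by move=> i; rewrite !mxE.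
Qed.

Lemma coord_continuous_at (R : realType) (T : topologicalType) k (f : T -> 'rV[R]_k) x i :
  {for x, continuous f} -> {for x, continuous (fun z => f z 0 i)}.
Proof. by move=> cf; exact: (continuous_comp cf (@coord_continuous R 1 k 0 i (f x))). Qed.

Lemma near_open (R : realType) n (Om : set 'rV[R]_n) x : open Om -> Om x ->
  \forall y \near x, Om y.
Proof. by move=> oOm Omx; exact: open_nbhs_nbhs. Qed.

Lemma eq_on_continuous (R : realType) n (T : topologicalType) (Om : set 'rV[R]_n)
    (f g : 'rV[R]_n -> T) x : open Om -> (forall y, Om y -> f y = g y) -> Om x ->
  {for x, continuous f} -> {for x, continuous g}.
Proof.
move=> oOm fg Omx cf; rewrite /prop_for /continuous_at -(fg _ Omx) => P /cf h.
have {}h : \forall y \near x, P (f y) by [].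
suff : \forall y \near x, P (g y) by [].
by apply: filterS2 h (near_open oOm Omx) => y Pf /fg <-.
Qed.

Section Components.
Context {R : realType} {n k : nat} (Om : set 'rV[R]_n) (f : 'rV[R]_n -> 'rV[R]_k).
Hypothesis openOm : open Om.

Lemma pdiff_coord js :
  (forall js x j, Om x -> derivable (pdiff js f) x (delta_mx 0 j)) ->
  forall x i, Om x -> pdiff js f x 0 i = spdiff js (fun z => f z 0 i) x.
Proof.
move=> df; elim: js => [//|j js IH] x i Omx /=.
rewrite derive_mx ?mxE; last exact: df.
apply: near_eq_derive; near=> y; apply: IH; near: y; exact: near_open.
Unshelve. all: by end_near. Qed.

(** The converse direction builds the derivability of the vector valued iterated
    derivative along with its components, since each order needs the previous one. *)
Lemma pdiff_coordV js :
  (forall i js x j, Om x -> derivable (spdiff js (fun z => f z 0 i)) x (delta_mx 0 j)) ->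
  forall x, Om x -> (forall j, derivable (pdiff js f) x (delta_mx 0 j)) /\
    forall i, pdiff js f x 0 i = spdiff js (fun z => f z 0 i) x.
Proof.
move=> df; elim: js => [|j js IH] x Omx.
  split=> // j; apply/derivable_mxP => i' i; rewrite ord1.
  exact: (df i [::]).
have E y i : Om y -> pdiff (j :: js) f y 0 i = spdiff (j :: js) (fun z => f z 0 i) y.
  move=> Omy; rewrite /= derive_mx ?mxE; last by have [] := IH y Omy.
  by apply: near_eq_derive; near=> z; have [|_ ->//] := IH z; near: z; exact: near_open.
split=> [j'|i]; last exact: E.
apply/derivable_mxP => i' i; rewrite ord1.
apply: near_eq_derivable (df i (j :: js) x j' Omx).
near=> y; apply/esym/E; near: y; exact: near_open.
Unshelve. all: by end_near. Qed.

End Components.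

(** * Representatives of generalized numbers *)

Section Representatives.
Context {R : realType} {rho : gauge R}.
Implicit Types (x y : gring rho) (a b : epsilon R -> R) (e : epsilon R).

Lemma rhoX_gt0 n e : 0 < rho e ^+ n.
Proof. by rewrite exprn_gt0 ?gauge_gt0. Qed.

Lemma rhoX_ge0 n e : 0 <= rho e ^+ n.
Proof. exact/ltW/rhoX_gt0. Qed.

Lemma rhoX_le m n e : (m <= n)%N -> rho e ^+ n <= rho e ^+ m.
Proof. by move=> mn; rewrite ler_wiXn2l ?gauge_le1 // ltW ?gauge_gt0. Qed.

Lemma rho_absorb (c : R) n : \forall e \near small R, c * rho e ^+ n.+1 <= rho e ^+ n.
Proof.
have c1 : 0 < `|c| + 1 by rewrite ltr_wpDl.
have c0 : 0 < (`|c| + 1)^-1 by rewrite invr_gt0.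
near=> e; rewrite exprS mulrA ler_piMl ?rhoX_ge0 //.
have re : rho e < (`|c| + 1)^-1 by near: e; exact: gauge_lt.
apply: le_trans (_ : (`|c| + 1) * rho e <= 1).
  by rewrite ler_pM2r ?gauge_gt0 // (le_trans (ler_norm c)) // lerDl.
by rewrite -ler_pdivlMl // mulr1; exact: ltW.
Unshelve. all: by end_near. Qed.

Lemma moderate_le a b : moderate rho b ->
  (\forall e \near small R, `|a e| <= `|b e|) -> moderate rho a.
Proof.
move=> [N bN] ab; exists N; near=> e; apply: le_trans (near ab e _) _ => //.
exact: (near bN e).
Unshelve. all: by end_near. Qed.

Lemma moderate_near a b : (\forall e \near small R, a e = b e) ->
  moderate rho a -> moderate rho b.
Proof.
move=> ab am; apply: moderate_le am _.
by apply: filterS ab => e ->.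
Qed.

Lemma moderate_cst (c : R) : moderate rho (fun=> c).
Proof.
exists 1%N; apply: filterS (rho_absorb `|c| 0) => e.
by rewrite expr0 -ler_pdivlMr ?rhoX_gt0 // mul1r.
Qed.

Lemma moderateN a : moderate rho a -> moderate rho (fun e => - a e).
Proof. by move=> am; apply: moderate_le am _; apply: nearW => e; rewrite normrN. Qed.

Lemma moderateD a b : moderate rho a -> moderate rho b ->
  moderate rho (fun e => a e + b e).
Proof.
move=> am /moderateN bm; have := moderateB am bm.
by apply: moderate_near; apply: nearW => e; rewrite -[LHS]/(a e - - b e) opprK.
Qed.

Lemma moderate_rhoX n : moderate rho (fun e => rho e ^+ n).
Proof.
apply: moderate_le (moderate_cst 1) _; apply: nearW => e.
by rewrite normr1 ger0_norm ?rhoX_ge0 // exprn_ile1 ?gauge_le1 // ltW ?gauge_gt0.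
Qed.

Lemma negligible_moderate a : negligible_net rho a -> moderate rho a.
Proof.
move=> /(_ 0%N) a0; apply: moderate_le (moderate_cst 1) _.
by apply: filterS a0 => e; rewrite normr1.
Qed.

Lemma represents_near a b x : (\forall e \near small R, a e = b e) ->
  represents a x -> represents b x.
Proof.
move=> ab [am <-]; have bm := moderate_near ab am; split=> //.
apply/cls_eqP => // n; apply: filterS ab => e ab.
by rewrite -[(b - a) e]/(b e - a e) ab subrr normr0 rhoX_ge0.
Qed.

Lemma represents_negligible a b x : represents a x -> represents b x ->
  negligible_net rho (a - b).
Proof. by move=> [am ax] [bm bx]; apply/cls_eqP => //; rewrite ax bx. Qed.

Lemma represents_close a b x : represents a x -> negligible_net rho (b - a) ->
  represents b x.
Proof.
move=> [am <-] ba; have bm : moderate rho b.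
  have := moderateD (negligible_moderate ba) am.
  by apply: moderate_near; apply: nearW => e; exact: subrK.
by split=> //; apply/cls_eqP.
Qed.

Lemma represents_fun a x y : represents a x -> represents a y -> x = y.
Proof. by move=> [_ <-] [_ <-]. Qed.

Lemma represents_cls a : moderate rho a -> represents a (cls a : gring rho).
Proof. by split. Qed.

Lemma represents_repr x : represents (net_of (repr x)) x.
Proof.
split; first by have /asboolP := net_ofP (repr x).
by rewrite /cls valKd; exact: reprK.
Qed.

Lemma represents_pi (u : moderate_net rho) : represents (net_of u) (\pi_(gring rho)%qT u).
Proof. by split; [exact/asboolP/net_ofP | rewrite /cls valKd]. Qed.

Lemma represents_net a x : represents a x -> exists2 u : moderate_net rho,
  net_of u = a & \pi_(gring rho)%qT u = x.
Proof.
move=> [am <-]; exists (insubd 0 a) => //.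
by rewrite [LHS]insubdK //; exact/asboolP.
Qed.

Lemma representsD a b x y : represents a x -> represents b y ->
  represents (fun e => a e + b e) (x + y).
Proof.
move=> /represents_net[u <- <-] /represents_net[v <- <-].
rewrite -rmorphD; have := represents_pi (u + v).
have -> // : net_of (u + v) = net_of u + net_of v.
exact: (raddfD (\val : moderate_net rho -> epsilon R -> R)).
Qed.

Lemma representsM a b x y : represents a x -> represents b y ->
  represents (fun e => a e * b e) (x * y).
Proof.
move=> /represents_net[u <- <-] /represents_net[v <- <-].
rewrite -rmorphM; have := represents_pi (u * v).
have -> // : net_of (u * v) = net_of u * net_of v.
exact: (rmorphM (\val : moderate_net rho -> epsilon R -> R)).
Qed.

Lemma represents0 : represents (fun=> 0) (0 : gring rho).
Proof. by rewrite -(rmorph0 (\pi_(gring rho)%qT)); have := represents_pi 0; rewrite net_of0. Qed.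

Lemma represents1 : represents (fun=> 1) (1 : gring rho).
Proof. by rewrite -(rmorph1 (\pi_(gring rho)%qT)); have := represents_pi 1; rewrite net_of1. Qed.

Lemma representsN a x : represents a x -> represents (fun e => - a e) (- x).
Proof.
move=> /represents_net[u <- <-].
rewrite -rmorphN; have := represents_pi (- u).
have -> // : net_of (- u) = - net_of u.
exact: (raddfN (\val : moderate_net rho -> epsilon R -> R)).
Qed.

(** * The sharp topology through representatives *)

Lemma gle_represents x y a b n : gle x y -> represents a x -> represents b y ->
  \forall e \near small R, a e <= b e + rho e ^+ n.
Proof.
move=> [a' [b' [a'x b'y ab]]] ax by_.
have /(_ n.+1) aa := represents_negligible ax a'x.
have /(_ n.+1) bb := represents_negligible b'y by_.
near=> e.
have h1 : `|(a - a') e| <= rho e ^+ n.+1 by near: e; exact: aa.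
have h2 : `|(b' - b) e| <= rho e ^+ n.+1 by near: e; exact: bb.
have h3 : 2 * rho e ^+ n.+1 <= rho e ^+ n by near: e; exact: rho_absorb.
have := ab e; move: h1 h2; rewrite !ler_norml.
move=> /andP[_ h1] /andP[_ h2] h4.
have {}h1 : a e - a' e <= rho e ^+ n.+1 := h1.
have {}h2 : b' e - b e <= rho e ^+ n.+1 := h2.
lra.
Unshelve. all: by end_near. Qed.

(** A gap [rho ^ m] makes the inverse of the difference moderate, hence the
    difference invertible. *)
Lemma glt_represents x y a b m : represents a x -> represents b y ->
  (\forall e \near small R, a e + rho e ^+ m <= b e) -> glt x y.
Proof.
move=> ax by_ ab; split.
  exists a, (fun e => Num.max (a e) (b e)); split=> //.
    apply: represents_near by_; apply: filterS ab => e ab.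
    by rewrite max_r // (le_trans _ ab) // lerDl rhoX_ge0.
  by move=> e; rewrite le_max lexx.
pose d e := b e - a e; pose c e := (d e)^-1.
have dr : represents d (y - x) := representsD by_ (representsN ax).
have cm : moderate rho c.
  exists m; apply: filterS ab => e; rewrite -lerBrDl => de.
  rewrite normfV lef_pV2 ?posrE ?rhoX_gt0 ?(le_trans de) ?ler_norm //.
  by rewrite normr_gt0 gt_eqF // (lt_le_trans _ de) // rhoX_gt0.
apply/asboolP; exists (cls c).
apply: represents_fun represents1.
apply: represents_near (representsM (represents_cls cm) dr).
apply: filterS ab => e; rewrite -lerBrDl => de.
by rewrite mulVf // gt_eqF // (lt_le_trans _ de) // rhoX_gt0.
Qed.

(** If [y] inverts [x], then [|a_e| >= 1 / (2 |b_e|)] for small [e], where [b]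
    represents [y] and is moderate; the order only serves to exclude [a_e < 0]. *)
Lemma glt0_represents x a : glt 0 x -> represents a x ->
  exists m, \forall e \near small R, rho e ^+ m <= a e.
Proof.
move=> [x0]; rewrite subr0 => /asboolP[y yx] ax.
have yr := represents_repr y; set b := net_of (repr y) in yr.
have [N bN] := yr.1.
have /(_ 1%N) n1 : negligible_net rho ((fun e => b e * a e) - (fun=> 1)).
  by apply: represents_negligible represents1; rewrite -yx; exact: representsM.
have a0 := gle_represents N.+2 x0 represents0 ax.
exists N.+1; near=> e.
have bNe : `|b e| <= rho e ^- N by near: e; exact: bN.
have n1e : `|b e * a e - 1| <= rho e ^+ 1 by near: e; exact: n1.
have a0e : 0 <= a e + rho e ^+ N.+2 by near: e; exact: a0.
have r1 : 4 * rho e ^+ 1 <= rho e ^+ 0 by near: e; exact: rho_absorb.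
rewrite expr0 expr1 in r1 n1e.
have rN : 2 * rho e ^+ N.+1 <= rho e ^+ N by near: e; exact: rho_absorb.
have rN' : 4 * rho e ^+ N.+2 <= rho e ^+ N.+1 by near: e; exact: rho_absorb.
have half : 2^-1 <= `|b e| * `|a e|.
  rewrite -normrM; apply: le_trans (ler_norm _).
  by move: n1e; rewrite ler_norml => /andP[n1e _]; lra.
have aN : rho e ^+ N.+1 <= `|a e|.
  have : 2^-1 <= rho e ^- N * `|a e| by apply: le_trans half _; rewrite ler_wpM2r.
  by rewrite ler_pdivlMl ?rhoX_gt0 // => h; lra.
have rp := rhoX_gt0 N.+1 e.
have [a_ge0|a_lt0] := leP 0 (a e); first by rewrite ger0_norm in aN.
by move: aN; rewrite ltr0_norm // => aN; lra.
Unshelve. all: by end_near. Qed.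

End Representatives.

Section Points.
Context {R : realType} {rho : gauge R}.
Implicit Types (e : epsilon R).

Definition mcls n (x_ : epsilon R -> 'rV[R]_n) : 'rV[gring rho]_n :=
  \row_j cls (fun e => x_ e 0 j).

Lemma mrepresents_mcls n (x_ : epsilon R -> 'rV[R]_n) :
  mmoderate (rho := rho) x_ -> mrepresents x_ (mcls x_).
Proof. by move=> xm i j; rewrite !ord1 mxE; exact: represents_cls (xm 0 j). Qed.

Lemma mrepresents_row n (x_ : epsilon R -> 'rV[R]_n) (x : 'rV[gring rho]_n) :
  (forall j, represents (fun e => x_ e 0 j) (x 0 j)) -> mrepresents x_ x.
Proof. by move=> xr i j; rewrite ord1. Qed.

Lemma mrepresents_mnet n (x : 'rV[gring rho]_n) : mrepresents (mnet x) x.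
Proof.
move=> i j; apply: represents_near (represents_repr _).
by apply: nearW => e; rewrite mxE.
Qed.

Lemma mrepresents_close n (x_ y_ : epsilon R -> 'rV[R]_n) (x : 'rV[gring rho]_n) m :
  mrepresents x_ x -> mrepresents y_ x ->
  \forall e \near small R, `|x_ e - y_ e| <= rho e ^+ m.
Proof.
move=> xr yr; have : \forall e \near small R, forall j, `|x_ e 0 j - y_ e 0 j| <= rho e ^+ m.
  apply: filter_forall => j; exact: (represents_negligible (xr 0 j) (yr 0 j)).
apply: filterS => e h; apply: row_norm_le; first exact: rhoX_ge0.
by move=> j; rewrite !mxE.
Qed.

Lemma mrepresentsB n (x_ y_ : epsilon R -> 'rV[R]_n) (x y : 'rV[gring rho]_n) :
  mrepresents x_ x -> mrepresents y_ y ->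
  mrepresents (fun e => x_ e - y_ e) (x - y).
Proof.
move=> xr yr i j; rewrite !mxE.
apply: represents_near (representsD (xr i j) (representsN (yr i j))).
by apply: nearW => e; rewrite !mxE.
Qed.

Lemma mmoderate_within n (x_ y_ : epsilon R -> 'rV[R]_n) m : mmoderate (rho := rho) x_ ->
  (\forall e \near small R, `|y_ e - x_ e| <= rho e ^+ m) -> mmoderate (rho := rho) y_.
Proof.
move=> xm xy i j; rewrite ord1.
have d : moderate rho (fun e => y_ e 0 j - x_ e 0 j).
  apply: moderate_le (moderate_rhoX m) _; apply: filterS xy => e.
  move=> /(le_trans (row_norm_coord _ j)); rewrite !mxE => h.
  by rewrite [leRHS]ger0_norm // rhoX_ge0.
apply: moderate_near (moderateD d (xm 0 j)).
by apply: nearW => e; rewrite subrK.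
Qed.

Lemma euclidean_ge n (A : 'rV[R]_n) : `|A| <= Num.sqrt (\sum_i \sum_j A i j ^+ 2).
Proof.
apply: row_norm_le => [|j]; first exact: sqrtr_ge0.
rewrite -sqrtr_sqr ler_wsqrtr // big_ord1 (bigD1 j) //= lerDl.
by apply: sumr_ge0 => i _; exact: sqr_ge0.
Qed.

Lemma euclidean_le n (A : 'rV[R]_n) :
  Num.sqrt (\sum_i \sum_j A i j ^+ 2) <= n.+1%:R * `|A|.
Proof.
rewrite -[leRHS]ger0_norm ?mulr_ge0 // -sqrtr_sqr ler_wsqrtr // big_ord1 exprMn.
apply: le_trans (_ : n%:R * `|A| ^+ 2 <= _); last first.
  rewrite ler_wpM2r ?sqr_ge0 // -natrX ler_nat.
  by rewrite (leq_trans (leqnSn n)) // -[leqLHS]expn1 leq_pexp2l.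
rewrite -[n in n%:R]card_ord mulr_natl -sumr_const; apply: ler_sum => j _.
by rewrite -real_normK ?num_real // lerXn2r ?nnegrE // row_norm_coord.
Qed.

Lemma mmoderate_norm n (x_ : epsilon R -> 'rV[R]_n) : mmoderate (rho := rho) x_ ->
  moderate rho (fun e => `|x_ e|).
Proof.
move=> xm; have [N xN] : exists N, forall j, \forall e \near small R, `|x_ e 0 j| <= rho e ^- N.
  have /choice[N NP] : forall j, exists N, \forall e \near small R, `|x_ e 0 j| <= rho e ^- N.
    by move=> j; exact: xm.
  exists (\max_j N j)%N => j; apply: filterS (NP j) => e h; apply: le_trans h _.
  by apply: gauge_exprN_le; exact: leq_bigmax.
exists N; have : \forall e \near small R, forall j, `|x_ e 0 j| <= rho e ^- N.
  exact: filter_forall.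
apply: filterS => e h; rewrite normr_id; apply: row_norm_le => //.
by rewrite invr_ge0 rhoX_ge0.
Qed.

Lemma moderate_euclidean n (x_ : epsilon R -> 'rV[R]_n) : mmoderate (rho := rho) x_ ->
  moderate rho (fun e => Num.sqrt (\sum_i \sum_j x_ e i j ^+ 2)).
Proof.
move=> xm; apply: moderate_le (moderateM (moderate_cst n.+1%:R) (mmoderate_norm xm)) _.
apply: nearW => e; rewrite [leLHS]ger0_norm ?sqrtr_ge0 //.
by rewrite [leRHS]ger0_norm ?mulr_ge0 //; exact: euclidean_le.
Qed.

Lemma represents_vnorm n (x : 'rV[gring rho]_n) :
  represents (fun e => Num.sqrt (\sum_i \sum_j mnet x e i j ^+ 2)) (vnorm x).
Proof.
apply/represents_cls/moderate_euclidean => i j.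
by have [] := mrepresents_mnet x i j.
Qed.

(** Interior points are recognised on nets: the sharp ball of radius [rho ^ m]
    is controlled by the inequality [|y_e - x_e| <= rho_e ^ m] up to a change of
    the exponent [m]. *)
Lemma sharp_interiorP n (X : set 'rV[gring rho]_n) (x : 'rV[gring rho]_n) :
  sharp_interior X x <-> exists m, forall x_ y_ y, mrepresents x_ x ->
    mrepresents y_ y -> (\forall e \near small R, `|y_ e - x_ e| <= rho e ^+ m) -> X y.
Proof.
split=> [[r r0 rX]|[m mX]].
  have rr := represents_repr r; set r_ := net_of (repr r) in rr.
  have [k rk] := glt0_represents r0 rr.
  exists k.+2 => x_ y_ y xr yr xy; apply: rX; rewrite /gball /=.
  apply: (glt_represents (m := k.+1) (represents_vnorm _) rr).
  have close := mrepresents_close k.+3 (mrepresents_mnet (y - x)) (mrepresentsB yr xr).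
  near=> e; have h0 := euclidean_le (mnet (y - x) e).
  apply: le_trans (_ : rho e ^+ k <= _); last by near: e; exact: rk.
  have h1 : `|mnet (y - x) e - (y_ e - x_ e)| <= rho e ^+ k.+3 by near: e; exact: close.
  have h2 : `|y_ e - x_ e| <= rho e ^+ k.+2 by near: e; exact: xy.
  have h3 : `|mnet (y - x) e| <= 2 * rho e ^+ k.+2.
    rewrite -[mnet _ e](subrK (y_ e - x_ e)) (le_trans (ler_normD _ _)) //.
    have h : rho e ^+ k.+3 <= rho e ^+ k.+2 by exact: rhoX_le.
    by have := lerD h1 h2; lra.
  have h4 : (n.+1%:R * 2) * rho e ^+ k.+2 <= rho e ^+ k.+1.
    by near: e; exact: rho_absorb.
  have h5 : 2 * rho e ^+ k.+1 <= rho e ^+ k by near: e; exact: rho_absorb.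
  have h6 : n.+1%:R * `|mnet (y - x) e| <= rho e ^+ k.+1.
    by apply: le_trans h4; rewrite -mulrA ler_wpM2l.
  lra.
exists (cls (fun e => rho e ^+ m.+1)).
  apply: (glt_represents (m := m.+1) represents0).
    exact/represents_cls/moderate_rhoX.
  by apply: nearW => e; rewrite add0r.
move=> y [+ _]; move=> yx; apply: (mX (mnet x) (mnet y)); try exact: mrepresents_mnet.
have rm : represents (fun e => rho e ^+ m.+1) (cls (fun e => rho e ^+ m.+1) : gring rho).
  exact/represents_cls/moderate_rhoX.
have h := gle_represents m.+1 yx (represents_vnorm _) rm.
have close := mrepresents_close m.+1 (mrepresents_mnet (y - x))
  (mrepresentsB (mrepresents_mnet y) (mrepresents_mnet x)).
near=> e.
have h1 : `|mnet (y - x) e - (mnet y e - mnet x e)| <= rho e ^+ m.+1 by near: e; exact: close.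
have h2 := euclidean_ge (mnet (y - x) e).
have h3 : 3 * rho e ^+ m.+1 <= rho e ^+ m by near: e; exact: rho_absorb.
have h4 : Num.sqrt (\sum_i \sum_j mnet (y - x) e i j ^+ 2) <= rho e ^+ m.+1 + rho e ^+ m.+1.
  by near: e; exact: h.
rewrite -[leLHS]normrN -[X in `|X|](addrK (mnet (y - x) e)) (le_trans (ler_normB _ _)) //.
rewrite [X in `|X| + _]addrC; lra.
Unshelve. all: by end_near. Qed.

Lemma sharp_open_prodv m n (X : set 'rV[gring rho]_m) (Y : set 'rV[gring rho]_n) :
  sharp_open X -> sharp_open Y -> sharp_open (prodv X Y).
Proof.
move=> oX oY x [/oX /sharp_interiorP[k kX] /oY /sharp_interiorP[k' kY]].
apply/sharp_interiorP; exists (maxn k k') => x_ y_ y xr yr xy.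
have lr (z_ : epsilon R -> 'rV[R]_(m + n)) (z : 'rV[gring rho]_(m + n)) : mrepresents z_ z ->
    mrepresents (fun e => lsubmx (z_ e)) (lsubmx z) /\
    mrepresents (fun e => rsubmx (z_ e)) (rsubmx z).
  by move=> zr; split=> i j; rewrite mxE; apply: represents_near (zr i _);
    apply: nearW => e; rewrite mxE.
have [xl xr'] := lr _ _ xr; have [yl yr'] := lr _ _ yr; split.
  apply: (kX _ _ _ xl yl); apply: filterS xy => e h.
  apply: row_norm_le => [|j]; first exact: rhoX_ge0.
  have := row_norm_coord (y_ e - x_ e) (lshift n j); rewrite !mxE => /le_trans; apply.
  by apply: le_trans h _; rewrite rhoX_le // leq_maxl.
apply: (kY _ _ _ xr' yr'); apply: filterS xy => e h.
apply: row_norm_le => [|j]; first exact: rhoX_ge0.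
have := row_norm_coord (y_ e - x_ e) (rshift m j); rewrite !mxE => /le_trans; apply.
by apply: le_trans h _; rewrite rhoX_le // leq_maxr.
Qed.

End Points.

(** * Nets of smooth functions with moderate derivatives *)

Lemma is_derive_coord (R : realType) n (x v : 'rV[R]_n) i :
  is_derive x v (fun z : 'rV[R]_n => z 0 i) (v 0 i).
Proof.
have did : derivable (id : 'rV[R]_n -> 'rV[R]_n) x v by exact: derivable_id.
split; first by have /derivable_mxP/(_ 0 i) := did.
have := derive_mx did; rewrite derive_id => /rowP/(_ i).
by rewrite mxE => <-.
Qed.

Section TameNets.
Context {R : realType} {rho : gauge R}.

(** The recursion differentiates first and then asks for the order below, so that
    stability under products and compositions takes a single induction on [m],
    quantified over all the nets. *)
Fixpoint tame n (m : nat) (Om : epsilon R -> set 'rV[R]_n)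
    (X : set 'rV[gring rho]_n) (F : epsilon R -> 'rV[R]_n -> R) : Prop :=
  [/\ forall e x, Om e x -> {for x, continuous (F e)},
      forall x_ x, X x -> mrepresents x_ x -> moderate rho (fun e => F e (x_ e)) &
      if m is m'.+1 then forall j,
        (forall e x, Om e x -> derivable (F e) x (delta_mx 0 j)) /\
        tame m' Om X (fun e => 'D_(delta_mx 0 j) (F e)) else True].

Lemma tame_continuous n m Om (X : set 'rV[gring rho]_n) F e x :
  tame m Om X F -> Om e x -> {for x, continuous (F e)}.
Proof. by case: m => [|m] [c _ _] /c. Qed.

Lemma tame_moderate n m Om (X : set 'rV[gring rho]_n) F x_ x :
  tame m Om X F -> X x -> mrepresents x_ x -> moderate rho (fun e => F e (x_ e)).
Proof. by case: m => [|m] [_ + _]; exact. Qed.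

Lemma tame_derivable n m Om (X : set 'rV[gring rho]_n) F j e x :
  tame m.+1 Om X F -> Om e x -> derivable (F e) x (delta_mx 0 j).
Proof. by case=> _ _ /(_ j)[+ _]; exact. Qed.

Lemma tame_derive n m Om (X : set 'rV[gring rho]_n) F j :
  tame m.+1 Om X F -> tame m Om X (fun e => 'D_(delta_mx 0 j) (F e)).
Proof. by case=> _ _ /(_ j)[]. Qed.

Lemma tameW n m Om (X : set 'rV[gring rho]_n) F : tame m.+1 Om X F -> tame m Om X F.
Proof.
elim: m F => [|m IH] F [c mo d]; split=> // j; have [dj tj] := d j.
by split=> //; exact: IH.
Qed.

Lemma tame_sub n m Om Om' (X X' : set 'rV[gring rho]_n) F :
  (forall e, Om' e `<=` Om e) -> X' `<=` X -> tame m Om X F -> tame m Om' X' F.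
Proof.
move=> OmS XS; elim: m F => [|m IH] F [c mo d]; split=> //.
- by move=> e x /OmS; exact: c.
- by move=> x_ x /XS; exact: mo.
- by move=> e x /OmS; exact: c.
- by move=> x_ x /XS; exact: mo.
- by move=> j; have [dj tj] := d j; split=> [e x /OmS|]; [exact: dj | exact: IH].
Qed.

Section Domain.
Context {n : nat} (Om : epsilon R -> set 'rV[R]_n) (X : set 'rV[gring rho]_n).
Hypothesis openOm : forall e, open (Om e).
Hypothesis strongOm : X `<=` strong_set Om.
Implicit Types (F G : epsilon R -> 'rV[R]_n -> R).

Lemma tame_eq m F G : (forall e x, Om e x -> F e x = G e x) ->
  tame m Om X F -> tame m Om X G.
Proof.
elim: m F G => [|m IH] F G FG tF.
all: have nFG e x : Om e x -> \forall y \near x, F e y = G e y by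
  move=> Omx; apply: filterS (near_open (@openOm e) Omx) => y; exact: FG.
all: have cG e x : Om e x -> {for x, continuous (G e)} by
  move=> Omx;
  exact: (eq_on_continuous (@openOm e) (FG e) Omx (tame_continuous tF Omx)).
all: have mG x_ x : X x -> mrepresents x_ x -> moderate rho (fun e => G e (x_ e)) by
  move=> Xx xr; apply: moderate_near (tame_moderate tF Xx xr);
  apply: filterS (strongOm Xx xr) => e; exact: FG.
all: split=> // j.
split.
  move=> e x Omx; apply: (@near_eq_derivable _ _ _ (F e) (G e)); first exact: nFG; exact: tame_derivable tF Omx.
apply: IH (tame_derive j tF) => e x Omx; apply: near_eq_derive; exact: nFG.
Qed.

Lemma tame_cst m (a : epsilon R -> R) : moderate rho a -> tame m Om X (fun e _ => a e).
Proof.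
elim: m a => [|m IH] a am; split=> //.
- by move=> e x _; exact: cst_continuous.
- by move=> e x _; exact: cst_continuous.
move=> j; split; first by move=> e x _; exact: derivable_cst.
have -> : (fun e => 'D_(delta_mx 0 j) (fun=> a e)) = (fun=> fun=> 0) :> (epsilon R -> 'rV[R]_n -> R).
  by apply/funext => e; apply/funext => x; exact: derive_cst.
by apply: IH; exact: moderate_cst.
Qed.

Lemma tame_coord m i : tame m Om X (fun _ x => x 0 i).
Proof.
have mo x_ x : X x -> mrepresents x_ x -> moderate rho (fun e => x_ e 0 i).
  by move=> _ xr; have [] := xr 0 i.
case: m => [|m]; split=> //.
- by move=> e x _; exact: coord_continuous.
- by move=> e x _; exact: coord_continuous.
move=> j; split; first by move=> e x _; have [] := is_derive_coord x (delta_mx 0 j) i.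
have -> : (fun e => 'D_(delta_mx 0 j) (fun x : 'rV[R]_n => x 0 i)) =
    (fun=> fun=> (delta_mx 0 j : 'rV[R]_n) 0 i) :> (epsilon R -> 'rV[R]_n -> R).
  apply/funext => e; apply/funext => x.
  by have [_ ->] := is_derive_coord x (delta_mx 0 j) i.
exact/tame_cst/moderate_cst.
Qed.

Lemma tameD m F G : tame m Om X F -> tame m Om X G ->
  tame m Om X (fun e x => F e x + G e x).
Proof.
elim: m F G => [|m IH] F G [cF mF dF] [cG mG dG].
all: split=> //.
all: try by move=> e x Omx; apply: continuousD; [exact: cF | exact: cG].
all: try by move=> x_ x Xx xr; apply: moderateD; [exact: mF Xx xr | exact: mG Xx xr].
move=> j; have [dFj tFj] := dF j; have [dGj tGj] := dG j; split.
  by move=> e x Omx; apply: derivableD; [exact: dFj | exact: dGj].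
apply: tame_eq (IH _ _ tFj tGj) => e x Omx.
by rewrite -deriveD; [|exact: dFj|exact: dGj].
Qed.

Lemma tameM m F G : tame m Om X F -> tame m Om X G ->
  tame m Om X (fun e x => F e x * G e x).
Proof.
elim: m F G => [|m IH] F G tF tG.
all: have [cF mF dF] := tF; have [cG mG dG] := tG; split=> //.
all: try by move=> e x Omx; apply: continuousM; [exact: cF | exact: cG].
all: try by move=> x_ x Xx xr; apply: moderateM; [exact: mF Xx xr | exact: mG Xx xr].
move=> j; have [dFj tFj] := dF j; have [dGj tGj] := dG j; split.
  by move=> e x Omx; apply: derivableM; [exact: dFj | exact: dGj].
apply: tame_eq (tameD (IH _ _ (tameW tF) tGj) (IH _ _ (tameW tG) tFj)) => e x Omx.
by rewrite -[X in X + _]/(F e x *: _) -[X in _ + X]/(G e x *: _) -deriveM;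
  [|exact: dFj|exact: dGj].
Qed.

Lemma tame_sum m I (r : seq I) (F_ : I -> epsilon R -> 'rV[R]_n -> R) :
  (forall i, tame m Om X (F_ i)) ->
  tame m Om X (fun e x => \sum_(i <- r) F_ i e x).
Proof.
move=> tF; elim: r => [|i r IH].
  by apply: tame_eq (tame_cst m (moderate_cst 0)) => e x _; rewrite big_nil.
by apply: tame_eq (tameD (tF i) IH) => e x _; rewrite big_cons.
Qed.

(** By the chain rule a derivative of the composite is a sum of products of nets
    that are tame to the order below, the first factors being again composites. *)
Lemma tame_comp k (Om' : epsilon R -> set 'rV[R]_k) (Y : set 'rV[gring rho]_k)
    (G : epsilon R -> 'rV[R]_n -> 'rV[R]_k) m (F : epsilon R -> 'rV[R]_k -> R) :
  (forall e, open (Om' e)) ->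
  (forall e x, Om e x -> Om' e (G e x)) ->
  (forall x_ x, X x -> mrepresents x_ x ->
     exists2 y, Y y & mrepresents (fun e => G e (x_ e)) y) ->
  (forall i, tame m Om X (fun e x => G e x 0 i)) ->
  tame m Om' Y F -> tame m Om X (fun e x => F e (G e x)).
Proof.
move=> openOm' OmG XG; elim: m F => [|m IH] F tG tF.
all: have [cF mF dF] := tF; split=> //.
all: try by move=> e x Omx; apply: (@continuous_comp _ _ _ (G e) (F e));
  [apply: row_continuous => i; exact: tame_continuous (tG i) Omx
  |exact: cF (OmG _ _ Omx)].
all: try by move=> x_ x Xx xr; have [y Yy yr] := XG _ _ Xx xr; exact: mF Yy yr.
have chain e x j : Om e x -> is_derive x (delta_mx 0 j) (fun z => F e (G e z))
    (\sum_i 'D_(delta_mx 0 i) (F e) (G e x) * 'D_(delta_mx 0 j) (fun z => G e z 0 i) x).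
  move=> Omx; apply: is_derive_chain.
  - by move=> i; exact: tame_derivable (tG i) Omx.
  - apply: filterS (near_open (openOm' e) (OmG _ _ Omx)) => y Omy i.
    exact: tame_derivable tF Omy.
  - by move=> i; exact: tame_continuous (tame_derive i tF) (OmG _ _ Omx).
move=> j; split; first by move=> e x Omx; have [] := chain e x j Omx.
have tS : tame m Om X (fun e x => \sum_i 'D_(delta_mx 0 i) (F e) (G e x) *
    'D_(delta_mx 0 j) (fun z => G e z 0 i) x).
  apply: tame_sum => i; apply: tameM; last exact: tame_derive (tG i).
  by apply: IH (tame_derive i tF) => i'; exact/tameW/tG.
by apply: tame_eq tS => e x Omx; have [_ ->] := chain e x j Omx.
Qed.

(** [tame] peels the innermost derivative of an iterated derivative, [spdiff] the
    outermost one, whence the induction on the end of the list. *)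
Lemma tameP F : (forall m, tame m Om X F) <-> forall js,
  (forall e x, Om e x -> {for x, continuous (spdiff js (F e))} /\
     forall j, derivable (spdiff js (F e)) x (delta_mx 0 j)) /\
  (forall x_ x, X x -> mrepresents x_ x -> moderate rho (fun e => spdiff js (F e) (x_ e))).
Proof.
split=> [+ js|+ m].
  elim/last_ind: js F => [|js j IH] F tF.
    split=> [e x Omx|x_ x Xx xr]; last exact: tame_moderate (tF 0%N) Xx xr.
    split; first exact: tame_continuous (tF 0%N) Omx.
    by move=> j; exact: tame_derivable (tF 1%N) Omx.
  have [] := IH (fun e => 'D_(delta_mx 0 j) (F e)) (fun m => tame_derive j (tF m.+1)).
  by move=> h1 h2; split=> [e x Omx|x_ x Xx xr]; rewrite /spdiff;
    [rewrite foldr_rcons; exact: h1 | under eq_fun do rewrite foldr_rcons; exact: h2 Xx xr].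
elim: m F => [|m IH] F FP; have [h1 h2] := FP [::]; split=> //.
- by move=> e x /h1[].
- by move=> e x /h1[].
move=> j; split; first by move=> e x /h1[].
apply: IH => js; have [h3 h4] := FP (rcons js j).
split=> [e x /h3|x_ x Xx /(h4 _ _ Xx)]; rewrite /spdiff; first by rewrite foldr_rcons.
by under eq_fun do rewrite foldr_rcons.
Qed.

End Domain.
End TameNets.

(** * Nets defining a generalized function; uniqueness of derivatives *)

Section ScalarNets.
Context {R : realType} {rho : gauge R}.
Implicit Types (n k : nat) (e : epsilon R).

Lemma moderate_mrepresents n (x_ : epsilon R -> 'rV[R]_n) (x : 'rV[gring rho]_n) :
  mrepresents x_ x -> mmoderate (rho := rho) x_.
Proof. by move=> xr i j; have [] := xr i j. Qed.

Lemma near_interior n (X : set 'rV[gring rho]_n) x x_ : sharp_interior X x ->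
  mrepresents x_ x -> exists m, forall y_,
    (\forall e \near small R, `|y_ e - x_ e| <= rho e ^+ m) ->
    exists2 y, X y & mrepresents y_ y.
Proof.
move=> /sharp_interiorP[m mX] xr; exists m => y_ yx.
have yr := mrepresents_mcls (mmoderate_within (moderate_mrepresents xr) yx).
by exists (mcls y_) => //; exact: mX xr yr yx.
Qed.

(** The second derivative is bounded by some [rho ^- N] on a whole segment around
    the point, so that a step [rho ^ M] in the difference quotient, with [M] large,
    costs an error as small as desired, while the values of [W] are negligible. *)
Lemma derive_negligible n Om (X : set 'rV[gring rho]_n) W x x_ j :
  X `<=` strong_set Om -> tame 2 Om X W ->
  (forall y_ y, X y -> mrepresents y_ y -> negligible_net rho (fun e => W e (y_ e))) ->
  sharp_interior X x -> mrepresents x_ x ->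
  negligible_net rho (fun e => 'D_(delta_mx 0 j) (W e) (x_ e)).
Proof.
move=> sOm tW Wn xint xr; have [m mX] := near_interior xint xr.
pose v : 'rV[R]_n := delta_mx 0 j.
have segm (s : epsilon R -> R) : (forall e, `|s e| <= rho e ^+ m) ->
    exists2 y, X y & mrepresents (fun e => s e *: v + x_ e) y.
  move=> sm; apply: mX; apply: nearW => e; rewrite addrK normrZ.
  by rewrite -[leRHS]mulr1 ler_pM // norm_delta_le.
(* for each e a point of the segment outside [Om e] is picked if there is one;
   these points form a generalized point of [X], where this cannot happen for small e *)
have B1 : \forall e \near small R, forall s, `|s| <= rho e ^+ m -> Om e (s *: v + x_ e).
  have /choice[s sP] : forall e, exists s, `|s| <= rho e ^+ m /\
      (Om e (s *: v + x_ e) -> forall s, `|s| <= rho e ^+ m -> Om e (s *: v + x_ e)).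
    move=> e; have [h|] := pselect (forall s, `|s| <= rho e ^+ m -> Om e (s *: v + x_ e)).
      by exists 0; split=> [|_]; [rewrite normr0 rhoX_ge0 | exact: h].
    by move=> /existsNP[s /not_implyP[sm nOm]]; exists s; split=> [|/nOm].
  have [|y Xy yr] := segm s; first by move=> e; have [] := sP e.
  by apply: filterS (sOm _ Xy _ yr) => e; exact: (sP e).2.
have tDD := tame_derive j (tame_derive j tW).
(* likewise with the point of the segment where the second derivative is largest *)
have [N B2] : exists N, \forall e \near small R, forall s, `|s| <= rho e ^+ m ->
    `|'D_v ('D_v (W e)) (s *: v + x_ e)| <= rho e ^- N.
  have /choice[s sP] : forall e, exists s, `|s| <= rho e ^+ m /\
      ((forall s, `|s| <= rho e ^+ m -> Om e (s *: v + x_ e)) -> forall t, `|t| <= rho e ^+ m ->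
       `|'D_v ('D_v (W e)) (t *: v + x_ e)| <= `|'D_v ('D_v (W e)) (s *: v + x_ e)|).
    move=> e; have [h|nh] := pselect (forall s, `|s| <= rho e ^+ m -> Om e (s *: v + x_ e)); last first.
      exists 0; split; last by move=> h; case: (nh h).
      by rewrite normr0; exact: rhoX_ge0.
    pose g (s : R) : R := `|'D_v ('D_v (W e)) (s *: v + x_ e)|.
    have itvE s : s \in `[- rho e ^+ m, rho e ^+ m] = (`|s| <= rho e ^+ m).
      by rewrite in_itv /= ler_norml.
    have cg : {within `[- rho e ^+ m, rho e ^+ m], continuous g}.
      apply: continuous_in_subspaceT => s; rewrite inE /= itvE => sm.
      apply: (@continuous_comp _ _ _ (fun s : R => 'D_v ('D_v (W e)) (s *: v + x_ e)) Num.norm).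
        apply: (@continuous_comp _ _ _ (fun s : R => s *: v + x_ e) ('D_v ('D_v (W e)))).
          apply: (@continuousD _ _ _ (fun s : R => s *: v) (cst (x_ e))).
            exact: scalel_continuous.
          exact: cst_continuous.
        exact: tame_continuous tDD (h _ sm).
      exact: norm_continuous.
    have le0 : - rho e ^+ m <= rho e ^+ m.
      by rewrite (le_trans (_ : _ <= 0)) ?oppr_le0 ?rhoX_ge0.
    have [s + sM] := EVT_max le0 cg; rewrite itvE => sm; exists s.
    split; first exact: sm.
    move=> _ t tm; have ti : t \in `[- rho e ^+ m, rho e ^+ m] by rewrite itvE.
    exact: (sM t ti).
  have [|y Xy yr] := segm s; first by move=> e; have [] := sP e.
  have [N NP] := tame_moderate tDD Xy yr; exists N.
  near=> e; move=> t tm; apply: le_trans ((sP e).2 _ t tm) _.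
    by near: e; exact: B1.
  by near: e; exact: NP.
(* the step is below [rho ^ m], to remain in the segment, and [rho ^ N] times
   smaller than the precision [rho ^ k.+1] *)
move=> k; pose M := (m + k.+1 + N)%N.
have mM : (m <= M)%N by rewrite /M -addnA leq_addr.
have Mm e : rho e ^+ M <= rho e ^+ m by exact: rhoX_le.
have [|y Xy yr] := segm (fun e => rho e ^+ M).
  by move=> e; rewrite ger0_norm ?rhoX_ge0.
have [|z Xz zr] := segm (fun e => 0); first by move=> e; rewrite normr0 rhoX_ge0.
have W1 := Wn _ _ Xy yr (M + k.+1)%N.
have W0 := Wn _ _ Xz zr (M + k.+1)%N.
near=> e.
have Ome : forall s, `|s| <= rho e ^+ m -> Om e (s *: v + x_ e) by near: e; exact: B1.
have DDe : forall s, `|s| <= rho e ^+ m -> `|'D_v ('D_v (W e)) (s *: v + x_ e)| <= rho e ^- N.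
  by near: e; exact: B2.
have W1e : `|W e (rho e ^+ M *: v + x_ e)| <= rho e ^+ (M + k.+1) by near: e; exact: W1.
have W0e : `|W e (x_ e)| <= rho e ^+ (M + k.+1).
  have : `|W e (0 *: v + x_ e)| <= rho e ^+ (M + k.+1) by near: e; exact: W0.
  by rewrite scale0r add0r.
have absorb : 3 * rho e ^+ k.+1 <= rho e ^+ k by near: e; exact: rho_absorb.
have hM : `|rho e ^+ M| = rho e ^+ M by rewrite ger0_norm ?rhoX_ge0.
have [s|s] := @line_MVT R n (W e) (x_ e) v (rho e ^+ M).
  by rewrite hM => sM; apply: tame_derivable tW (Ome _ (le_trans sM (Mm e))).
rewrite hM => sM E1.
have [t ts|t ts E2] := @line_MVT R n ('D_v (W e)) (x_ e) v s.
  apply: tame_derivable (tame_derive j tW) (Ome _ _).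
  exact: le_trans ts (le_trans sM (Mm e)).
have tm : `|t| <= rho e ^+ m := le_trans ts (le_trans sM (Mm e)).
have {}DDe := DDe t tm.
set D0 := 'D_v (W e) (x_ e) in E2 *; set Ds := 'D_v (W e) (s *: v + x_ e) in E1 E2.
set DD := 'D_v _ _ in E2 DDe.
have bound : rho e ^+ M * `|D0| <= rho e ^+ M * (3 * rho e ^+ k.+1).
  have -> : rho e ^+ M * `|D0| =
      `|W e (rho e ^+ M *: v + x_ e) - W e (x_ e) - rho e ^+ M * (s * DD)|.
    by rewrite E1 -E2 -mulrBr opprB addrC subrK normrM hM.
  have b3 : `|s * DD| <= rho e ^+ k.+1.
    rewrite normrM; apply: le_trans (ler_pM _ _ sM DDe) _ => //.
    rewrite /M exprD mulfK ?gt_eqF ?rhoX_gt0 //.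
    by apply: rhoX_le; exact: leq_addl.
  have b4 : `|rho e ^+ M * (s * DD)| <= rho e ^+ M * rho e ^+ k.+1.
    by rewrite normrM hM ler_wpM2l ?rhoX_ge0.
  rewrite exprD in W1e W0e.
  apply: le_trans (ler_normB _ _) _; have := ler_normB (W e (rho e ^+ M *: v + x_ e)) (W e (x_ e)).
  move=> b5; have b6 := lerD W1e W0e; lra.
by move: bound; rewrite ler_pM2l ?rhoX_gt0 // => /le_trans; exact.
Unshelve. all: by end_near. Qed.

Definition snet n (X : set 'rV[gring rho]_n) (f : 'rV[gring rho]_n -> gring rho)
    (Om : epsilon R -> set 'rV[R]_n) (F : epsilon R -> 'rV[R]_n -> R) : Prop :=
  [/\ forall e, open (Om e), X `<=` strong_set Om, forall m, tame m Om X F &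
      forall x_ x, X x -> mrepresents x_ x -> represents (fun e => F e (x_ e)) (f x)].

Lemma snet_sub n (X X' : set 'rV[gring rho]_n) f Om Om' F : (forall e, open (Om' e)) ->
  X' `<=` strong_set Om' -> (forall e, Om' e `<=` Om e) -> X' `<=` X ->
  snet X f Om F -> snet X' f Om' F.
Proof.
move=> oOm' sOm' OmS XS [oOm sOm tF rF]; split=> //.
  by move=> m; exact: tame_sub (tF m).
by move=> x_ x /XS; exact: rF.
Qed.

Lemma snet_restrict n (X X' : set 'rV[gring rho]_n) f Om F : X' `<=` X ->
  snet X f Om F -> snet X' f Om F.
Proof.
move=> XS sF; have [oOm sOm _ _] := sF.
have sOm' : X' `<=` strong_set Om by move=> x /XS /sOm.
by apply: (snet_sub oOm sOm' _ XS sF) => e x.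
Qed.

Lemma snet_ext n (X : set 'rV[gring rho]_n) f g Om F : {in X, f =1 g} ->
  snet X f Om F -> snet X g Om F.
Proof.
move=> fg [oOm sOm tF rF]; split=> // x_ x Xx xr.
by rewrite -fg ?inE //; exact: rF.
Qed.

Lemma snet_eq n (X : set 'rV[gring rho]_n) f Om F G :
  (forall e x, Om e x -> F e x = G e x) -> snet X f Om F -> snet X f Om G.
Proof.
move=> FG [oOm sOm tF rF]; split=> // [m|x_ x Xx xr]; first exact: tame_eq (tF m).
apply: represents_near (rF _ _ Xx xr); apply: filterS (sOm _ Xx _ xr) => e; exact: FG.
Qed.

Lemma openI_strong n (X : set 'rV[gring rho]_n) Om Om' :
  X `<=` strong_set Om -> X `<=` strong_set Om' ->
  X `<=` strong_set (fun e => Om e `&` Om' e).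
Proof.
move=> h h' x Xx x_ xr; have := h _ Xx _ xr; have := h' _ Xx _ xr.
by apply: filterS2 => e; split.
Qed.

Lemma snetD n (X : set 'rV[gring rho]_n) f g Om F G : snet X f Om F -> snet X g Om G ->
  snet X (fun x => f x + g x) Om (fun e x => F e x + G e x).
Proof.
move=> [oOm sOm tF rF] [_ _ tG rG]; split=> // [m|x_ x Xx xr]; first exact: tameD.
by apply: representsD; [exact: rF | exact: rG].
Qed.

Lemma snetM n (X : set 'rV[gring rho]_n) f g Om F G : snet X f Om F -> snet X g Om G ->
  snet X (fun x => f x * g x) Om (fun e x => F e x * G e x).
Proof.
move=> [oOm sOm tF rF] [_ _ tG rG]; split=> // [m|x_ x Xx xr]; first exact: tameM.
by apply: representsM; [exact: rF | exact: rG].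
Qed.

Lemma snet_cst n (X : set 'rV[gring rho]_n) (c : gring rho) a : represents a c ->
  snet X (fun=> c) (fun=> setT) (fun e _ => a e).
Proof.
move=> ac; split=> //.
- by move=> e; exact: openT.
- by move=> x _ x_ _; exact: nearW.
- by move=> m; apply: tame_cst; have [] := ac.
Qed.

Lemma snet_common n (X : set 'rV[gring rho]_n) f g Om Om' F G :
  snet X f Om F -> snet X g Om' G ->
  snet X f (fun e => Om e `&` Om' e) F /\ snet X g (fun e => Om e `&` Om' e) G.
Proof.
move=> sF sG; have [oF SF _ _] := sF; have [oG SG _ _] := sG.
have oI e : open (Om e `&` Om' e) by exact: openI.
have sI := openI_strong SF SG.
split; first by apply: (snet_sub oI sI _ _ sF) => // e x [].
by apply: (snet_sub oI sI _ _ sG) => // e x [].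
Qed.

(** The difference of the two nets represents 0 at every point of [X]. *)
Lemma derive_snets n (X : set 'rV[gring rho]_n) f Om Om' F F' x x_ j :
  snet X f Om F -> snet X f Om' F' -> sharp_interior X x -> mrepresents x_ x ->
  negligible_net rho ((fun e => 'D_(delta_mx 0 j) (F' e) (x_ e)) -
                      (fun e => 'D_(delta_mx 0 j) (F e) (x_ e))).
Proof.
move=> sF sF' xint xr; have [{}sF' {}sF] := snet_common sF' sF.
set Om2 := (fun e => _) in sF sF'.
have [oOm sOm tF rF] := sF; have [_ _ tF' rF'] := sF'.
have Xx : X x.
  have /sharp_interiorP[m mX] := xint; apply: (mX _ _ _ xr xr).
  by apply: nearW => e; rewrite subrr normr0 rhoX_ge0.
pose W e z := F' e z + (-1) * F e z.
have tW : tame 2 Om2 X W.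
  by apply: tameD => //; apply: tameM => //; apply: tame_cst; exact: moderate_cst.
have Wn y_ y : X y -> mrepresents y_ y -> negligible_net rho (fun e => W e (y_ e)).
  move=> Xy yr; have := represents_negligible (rF' _ _ Xy yr) (rF _ _ Xy yr).
  by move=> h k; apply: filterS (h k) => e; rewrite /W mulN1r.
move=> k; have := derive_negligible j sOm tW Wn xint xr k.
apply: filterS2 (sOm _ Xx _ xr) => e Ome.
have dF := tame_derivable (j := j) (tF 1%N) Ome.
have dF' := tame_derivable (j := j) (tF' 1%N) Ome.
have -> : W e = F' e - F e by apply/funext => z; rewrite /W mulN1r.
by rewrite deriveB.
Qed.

(** A change of representative is a translation by a negligible vector, which
    turns a defining net into another net defining the same function. *)
Lemma snet_shift n (X : set 'rV[gring rho]_n) f Om F (x : 'rV[gring rho]_n) x_ x'_ :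
  snet X f Om F -> mrepresents x_ x -> mrepresents x'_ x ->
  snet X f (fun e z => Om e (z + (x'_ e - x_ e))) (fun e z => F e (z + (x'_ e - x_ e))).
Proof.
move=> [oOm sOm tF rF] xr x'r; pose c e := x'_ e - x_ e.
have shift_rep y_ (y : 'rV[gring rho]_n) : mrepresents y_ y ->
    mrepresents (fun e => y_ e + c e) y.
  move=> yr i k; rewrite ord1 -[y 0 k]addr0 -[X in _ + X](subrr (x 0 k)).
  apply: represents_near (representsD (yr 0 k) (representsD (x'r 0 k) (representsN (xr 0 k)))).
  by apply: nearW => e; rewrite !mxE.
have contc e : continuous (fun z : 'rV[R]_n => z + c e).
  by move=> z; apply: (@continuousD _ _ _ id (cst (c e))); [exact: cvg_id|exact: cst_continuous].
have oOm' e : open ((fun z => z + c e) @^-1` Om e).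
  by apply: open_comp => // z _; exact: contc.
have sOm' : X `<=` strong_set (fun e z => Om e (z + c e)).
  by move=> y Xy y_ /shift_rep; exact: sOm.
split=> // [m|y_ y Xy /shift_rep]; last exact: rF.
apply: (@tame_comp _ _ _ _ _ oOm' sOm' _ Om X (fun e z => z + c e)) => //.
  by move=> y_ y Xy /shift_rep yr; exists y; [exact: Xy | exact: yr].
move=> i; apply: tame_eq (tameD oOm' sOm' (tame_coord _ _ m i)
    (tame_cst _ _ m (a := fun e => c e 0 i) _)) => //.
  by move=> e z _; rewrite !mxE.
have [cm _] := representsD (x'r 0 i) (representsN (xr 0 i)).
by apply: moderate_near cm; apply: nearW => e; rewrite !mxE.
Qed.

Lemma derive_shift_at n (F : 'rV[R]_n -> R) (c x v : 'rV[R]_n) :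
  'D_v (fun z => F (z + c)) x = 'D_v F (x + c).
Proof.
have E : (fun h : R => h^-1 *: (F (h *: v + x + c) - F (x + c))) =
         (fun h : R => h^-1 *: (F (h *: v + (x + c)) - F (x + c))).
  by apply/funext => h; rewrite addrA.
by rewrite /derive /= E.
Qed.

Lemma derive_represents n (X : set 'rV[gring rho]_n) f Om Om' F F' x x_ x'_ j (y : gring rho) :
  snet X f Om F -> snet X f Om' F' -> sharp_interior X x ->
  mrepresents x_ x -> mrepresents x'_ x ->
  represents (fun e => 'D_(delta_mx 0 j) (F e) (x_ e)) y ->
  represents (fun e => 'D_(delta_mx 0 j) (F' e) (x'_ e)) y.
Proof.
move=> sF sF' xint xr x'r ry; have sF'' := snet_shift sF' xr x'r.
apply: represents_near (represents_close ry (derive_snets j sF sF'' xint xr)).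
by apply: nearW => e; rewrite derive_shift_at addrC subrK.
Qed.

(** * Partial derivatives of scalar generalized functions on sharply open sets *)

(** A relation between functions rather than an operator: a function and its
    derivative share one net, so that each rule of calculus is a computation with
    ordinary derivatives and yields existence and value together. *)
Definition is_gder n (X : set 'rV[gring rho]_n) (f : 'rV[gring rho]_n -> gring rho)
    (j : 'I_n) (g : 'rV[gring rho]_n -> gring rho) : Prop :=
  exists Om F, snet X f Om F /\ snet X g Om (fun e => 'D_(delta_mx 0 j) (F e)).

Definition sgsf n (X : set 'rV[gring rho]_n) (f : 'rV[gring rho]_n -> gring rho) : Prop :=
  exists Om F, snet X f Om F.

(** Every net of [f] computes its derivatives; this brings functions given with
    unrelated nets to a common one. *)
Lemma gder_net n (X : set 'rV[gring rho]_n) f Om F j g : sharp_open X ->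
  is_gder X f j g -> snet X f Om F -> snet X g Om (fun e => 'D_(delta_mx 0 j) (F e)).
Proof.
move=> oX [Om' [F' [sF' sg]]] sF; have [oOm sOm tF rF] := sF.
have [_ _ _ rg] := sg.
split; [exact: oOm | exact: sOm | by move=> m; exact: tame_derive (tF m.+1) |].
move=> x_ x Xx xr.
exact: (derive_represents sF' sF (oX _ Xx) xr xr (rg _ _ Xx xr)).
Qed.

Lemma gder_unique n (X : set 'rV[gring rho]_n) f j g g' x : sharp_open X ->
  is_gder X f j g -> is_gder X f j g' -> X x -> g x = g' x.
Proof.
move=> oX [Om [F [sF sg]]] fg' Xx; have sg' := gder_net oX fg' sF.
have xr := mrepresents_mnet x; have [_ _ _ rg] := sg; have [_ _ _ rg'] := sg'.
exact: represents_fun (rg _ _ Xx xr) (rg' _ _ Xx xr).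
Qed.

Lemma snet_gder n (X : set 'rV[gring rho]_n) f Om F j : sharp_open X -> snet X f Om F ->
  exists g, snet X g Om (fun e => 'D_(delta_mx 0 j) (F e)).
Proof.
move=> oX sF; have [oOm sOm tF rF] := sF.
exists (fun x => cls (fun e => 'D_(delta_mx 0 j) (F e) (mnet x e))).
split; [exact: oOm | exact: sOm | by move=> m; exact: tame_derive (tF m.+1) |].
move=> x_ x Xx xr; have xr' := mrepresents_mnet x.
apply: (derive_represents sF sF (oX _ Xx) xr' xr); apply: represents_cls.
exact: tame_moderate (tame_derive j (tF 1%N)) Xx xr'.
Qed.

Lemma gder_sgsf n (X : set 'rV[gring rho]_n) f j g : is_gder X f j g -> sgsf X f.
Proof. by move=> [Om [F [sF _]]]; exists Om, F. Qed.

Lemma gder_sgsf' n (X : set 'rV[gring rho]_n) f j g : is_gder X f j g -> sgsf X g.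
Proof. by move=> [Om [F [_ sF]]]; eexists; eexists; exact: sF. Qed.

Lemma gder_ext n (X : set 'rV[gring rho]_n) f f' j g g' : {in X, f =1 f'} ->
  {in X, g =1 g'} -> is_gder X f j g -> is_gder X f' j g'.
Proof.
by move=> ff gg [Om [F [sF sG]]]; exists Om, F; split; [exact: (snet_ext ff sF)|exact: (snet_ext gg sG)].
Qed.

Lemma gder_cst n (X : set 'rV[gring rho]_n) c j : is_gder X (fun=> c) j (fun=> 0).
Proof.
exists (fun=> setT), (fun e _ => net_of (repr c) e); split.
  exact/snet_cst/represents_repr.
apply: snet_eq (snet_cst X represents0) => e x _.
by rewrite derive_cst.
Qed.

Lemma gder_coord n (X : set 'rV[gring rho]_n) i j :
  is_gder X (fun x => x 0 i) j (fun=> (i == j)%:R).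
Proof.
exists (fun=> setT), (fun e x => x 0 i).
have sT : X `<=` strong_set (fun=> setT) by move=> x _ x_ _; exact: nearW.
split.
  split=> //; [by move=> e; exact: openT |].
  by move=> m; exact: tame_coord.
have r : represents (fun=> (i == j)%:R) ((i == j)%:R : gring rho).
  by case: (i == j); [exact: represents1 | exact: represents0].
apply: snet_eq (snet_cst X r) => e x _.
by have [_ ->] := is_derive_coord x (delta_mx 0 j) i; rewrite mxE eqxx.
Qed.

Lemma gderD n (X : set 'rV[gring rho]_n) f f' g g' j :
  is_gder X f j f' -> is_gder X g j g' ->
  is_gder X (fun x => f x + g x) j (fun x => f' x + g' x).
Proof.
move=> [Om [F [sF sF']]] [Om' [G [sG sG']]].
have [{}sF {}sG] := snet_common sF sG; have [{}sF' {}sG'] := snet_common sF' sG'.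
eexists; eexists; split; first exact: snetD sF sG.
apply: snet_eq (snetD sF' sG') => e x Omx.
have [_ _ tF _] := sF; have [_ _ tG _] := sG.
by rewrite -deriveD; [|exact: tame_derivable (tF 1%N) Omx|exact: tame_derivable (tG 1%N) Omx].
Qed.

Lemma gderM n (X : set 'rV[gring rho]_n) f f' g g' j :
  is_gder X f j f' -> is_gder X g j g' ->
  is_gder X (fun x => f x * g x) j (fun x => f x * g' x + g x * f' x).
Proof.
move=> [Om [F [sF sF']]] [Om' [G [sG sG']]].
have [{}sF {}sG] := snet_common sF sG; have [{}sF' {}sG'] := snet_common sF' sG'.
eexists; eexists; split; first exact: snetM sF sG.
apply: snet_eq (snetD (snetM sF sG') (snetM sG sF')) => e x Omx.
have [_ _ tF _] := sF; have [_ _ tG _] := sG.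
rewrite -[X in X + _]/(F e x *: _) -[X in _ + X]/(G e x *: _) -deriveM //.
  exact: tame_derivable (tF 1%N) Omx.
exact: tame_derivable (tG 1%N) Omx.
Qed.

Lemma gderN n (X : set 'rV[gring rho]_n) f f' j :
  is_gder X f j f' -> is_gder X (fun x => - f x) j (fun x => - f' x).
Proof.
move=> ff; apply: gder_ext (gderM (gder_cst X (-1) j) ff) => x _ /=.
  by rewrite mulN1r.
by rewrite mulN1r mulr0 addr0.
Qed.

Lemma gder_sum n (X : set 'rV[gring rho]_n) I (r : seq I) f f' j :
  (forall i, is_gder X (f i) j (f' i)) ->
  is_gder X (fun x => \sum_(i <- r) f i x) j (fun x => \sum_(i <- r) f' i x).
Proof.
move=> ff; elim: r => [|i r IH].
  by apply: gder_ext (gder_cst X 0 j) => x _; rewrite big_nil.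
by apply: gder_ext (gderD (ff i) IH) => x _; rewrite big_cons.
Qed.

Lemma gder_schwarz n (X : set 'rV[gring rho]_n) f i j fi fj fij : sharp_open X ->
  is_gder X f i fi -> is_gder X f j fj -> is_gder X fi j fij -> is_gder X fj i fij.
Proof.
move=> oX [Om [F [sF sFi]]] fjP fijP.
have sFj := gder_net oX fjP sF; have sFij := gder_net oX fijP sFi.
exists Om, (fun e => 'D_(delta_mx 0 j) (F e)); split; first exact: sFj.
apply: snet_eq sFij => e x Omx; have [oOm _ tF _] := sF.
apply: schwarz => [|k m].
  apply: filterS (near_open (oOm e) Omx) => y Omy k; split=> [|m].
    exact: tame_derivable (tF 1%N) Omy.
  exact: tame_derivable (tame_derive k (tF 2)) Omy.
exact: tame_continuous (tame_derive m (tame_derive k (tF 2))) Omx.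
Qed.

End ScalarNets.

(** * Vector valued generalized smooth functions *)

Section VectorFunctions.
Context {R : realType} {rho : gauge R}.
Implicit Types (n k : nat) (e : epsilon R).

(** Reduces vector valued maps to scalar ones; the codomain [Y] only constrains
    values. *)
Lemma gsf_netP n k (X : set 'rV[gring rho]_n) (Y : set 'rV[gring rho]_k) f Om f_ :
  gsf_net X Y f Om f_ <->
  [/\ forall e, open (Om e), X `<=` strong_set Om, forall x, X x -> Y (f x) &
      forall i, snet X (fun x => f x 0 i) Om (fun e x => f_ e x 0 i)].
Proof.
split=> [[oOm smOm sOm fP]|[oOm sOm fY fP]].
  split; [exact: oOm | exact: sOm | |].
    by move=> x Xx; have [] := fP x _ Xx (mrepresents_mnet x).
  move=> i; split; [exact: oOm | exact: sOm | |]; last first.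
    by move=> x_ x Xx xr; have [_ r _] := fP x x_ Xx xr; exact: r.
  have dP e js x j : Om e x -> derivable (pdiff js (f_ e)) x (delta_mx 0 j).
    by move=> Omx; have [_] := smOm e js x Omx; exact.
  have E e js y : Om e y -> pdiff js (f_ e) y 0 i = spdiff js (fun x => f_ e x 0 i) y.
    by move=> Omy; apply: (pdiff_coord (oOm e)) => // js' x j; exact: dP.
  apply/(tameP _ _ _) => js; split=> [e x Omx|x_ x Xx xr].
    split=> [|j].
      apply: (eq_on_continuous (oOm e) (E e js) Omx).
      by apply: coord_continuous_at; have [] := smOm e js x Omx.
    have d : derivable (fun y => pdiff js (f_ e) y 0 i) x (delta_mx 0 j).
      by have /derivable_mxP/(_ 0 i) := dP e js x j Omx.
    apply: (@near_eq_derivable _ _ _ (fun y => pdiff js (f_ e) y 0 i)) => //.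
    by apply: filterS (near_open (oOm e) Omx) => y; exact: E.
  have [_ _ /(_ js 0 i)] := fP x x_ Xx xr.
  apply: moderate_near; apply: filterS (sOm _ Xx _ xr) => e; exact: E.
have dP i e js x j : Om e x -> derivable (spdiff js (fun z => f_ e z 0 i)) x (delta_mx 0 j).
  move=> Omx; have [_ _ tF _] := fP i.
  have [h _] := (tameP Om X _).1 tF js.
  by have [_] := h e x Omx; exact.
have E e js x : Om e x -> (forall j, derivable (pdiff js (f_ e)) x (delta_mx 0 j)) /\
    forall i, pdiff js (f_ e) x 0 i = spdiff js (fun z => f_ e z 0 i) x.
  by apply: (pdiff_coordV (oOm e)) => i js' x' j; exact: dP.
split; [exact: oOm | | exact: sOm |].
  move=> e js x Omx; split; last by have [] := E e js x Omx.
  apply: row_continuous => i; have [_ _ tF _] := fP i.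
  have [h _] := (tameP Om X _).1 tF js; have [c _] := h e x Omx.
  apply: (eq_on_continuous (oOm e) _ Omx c) => y Omy.
  by have [_ ->] := E e js y Omy.
move=> x x_ Xx xr; split; first exact: fY.
  by move=> i0 i; rewrite ord1; have [_ _ _ r] := fP i; exact: r.
move=> js i0 i; rewrite ord1; have [_ _ tF _] := fP i.
have [_ h] := (tameP Om X _).1 tF js.
apply: moderate_near (h _ _ Xx xr); apply: filterS (sOm _ Xx _ xr) => e Omx.
by have [_ ->] := E e js _ Omx.
Qed.

Lemma gsf_sgsf n k (X : set 'rV[gring rho]_n) (Y : set 'rV[gring rho]_k) f i :
  gsf X Y f -> sgsf X (fun x => f x 0 i).
Proof. by move=> [Om [f_ /gsf_netP[_ _ _ /(_ i) fi]]]; exists Om, (fun e x => f_ e x 0 i). Qed.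

Lemma gsf_val n k (X : set 'rV[gring rho]_n) (Y : set 'rV[gring rho]_k) f x :
  gsf X Y f -> X x -> Y (f x).
Proof. by move=> [Om [f_ /gsf_netP[_ _ + _]]]; exact. Qed.

Lemma gsf_row n k (X : set 'rV[gring rho]_n) (Y : set 'rV[gring rho]_k) f :
  (forall x, X x -> Y (f x)) -> (forall i, sgsf X (fun x => f x 0 i)) -> gsf X Y f.
Proof.
move=> fY fs; have /choice[Om OmP] := fs; have /choice[F FP] := OmP.
pose Om0 e : set 'rV[R]_n := [set x | forall i, Om i e x].
have oOm0 e : open (Om0 e).
  rewrite openE => x Omx.
  have H (i : 'I_k) : \forall y \near x, Om i e y.
    have [oOm _ _ _] := FP i; have Omix : Om i e x := Omx i.
    exact: (near_open (oOm e) Omix).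
  exact: (@filter_forall _ 'I_k (fun i => Om i e) _ _ H).
have sOm0 : X `<=` strong_set Om0.
  move=> x Xx x_ xr.
  have H (i : 'I_k) : \forall e \near small R, Om i e (x_ e).
    by have [_ sOm _ _] := FP i; exact: (sOm _ Xx _ xr).
  exact: (@filter_forall _ 'I_k (fun i e => Om i e (x_ e)) _ _ H).
exists Om0, (fun e x => \row_i F i e x); apply/gsf_netP; split=> // i.
have sF : snet X (fun x => f x 0 i) Om0 (F i).
  by apply: (snet_sub oOm0 sOm0 _ _ (FP i)) => // e x; exact.
by apply: snet_eq sF => e x _; rewrite mxE.
Qed.

Lemma gsf_weaken n k (X X' : set 'rV[gring rho]_n) (Y Y' : set 'rV[gring rho]_k) f :
  X' `<=` X -> (forall x, X' x -> Y' (f x)) -> gsf X Y f -> gsf X' Y' f.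
Proof.
move=> XS fY' fP; apply: gsf_row => // i; have [Om [F sF]] := gsf_sgsf i fP.
by exists Om, F; exact: snet_restrict sF.
Qed.

Lemma sgsf_cst n (X : set 'rV[gring rho]_n) c : sgsf X (fun=> c).
Proof. by do 2 eexists; exact: snet_cst (represents_repr c). Qed.

Lemma sgsf_coord n (X : set 'rV[gring rho]_n) i : sgsf X (fun x => x 0 i).
Proof. exact: gder_sgsf (gder_coord X i i). Qed.

Lemma sgsfD n (X : set 'rV[gring rho]_n) f g : sgsf X f -> sgsf X g ->
  sgsf X (fun x => f x + g x).
Proof.
move=> [Om [F sF]] [Om' [G sG]]; have [{}sF {}sG] := snet_common sF sG.
by do 2 eexists; exact: snetD sF sG.
Qed.

Lemma sgsfM n (X : set 'rV[gring rho]_n) f g : sgsf X f -> sgsf X g ->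
  sgsf X (fun x => f x * g x).
Proof.
move=> [Om [F sF]] [Om' [G sG]]; have [{}sF {}sG] := snet_common sF sG.
by do 2 eexists; exact: snetM sF sG.
Qed.

Lemma sgsf_ext n (X : set 'rV[gring rho]_n) f g : {in X, f =1 g} -> sgsf X f -> sgsf X g.
Proof. by move=> fg [Om [F sF]]; exists Om, F; exact: (snet_ext fg sF). Qed.

Lemma snet_sum n (X : set 'rV[gring rho]_n) I (r : seq I) f Om F :
  (forall e, open (Om e)) -> X `<=` strong_set Om ->
  (forall i, snet X (f i) Om (F i)) ->
  snet X (fun x => \sum_(i <- r) f i x) Om (fun e x => \sum_(i <- r) F i e x).
Proof.
move=> oOm sOm sF; elim: r => [|i r IH].
  have : snet X (fun=> 0) Om (fun _ _ => 0).
    by apply: (snet_sub oOm sOm _ _ (snet_cst X represents0)).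
  move=> s0; apply: (snet_eq (F := fun _ _ => 0)); first by move=> e x _; rewrite big_nil.
  by apply: snet_ext s0 => x _; rewrite big_nil.
apply: (snet_eq (F := fun e x => F i e x + \sum_(j <- r) F j e x)).
  by move=> e x _; rewrite big_cons.
by apply: snet_ext (snetD (sF i) IH) => x _; rewrite big_cons.
Qed.

Lemma sgsf_sum n (X : set 'rV[gring rho]_n) I (r : seq I) f :
  (forall i, sgsf X (f i)) -> sgsf X (fun x => \sum_(i <- r) f i x).
Proof.
move=> sf; elim: r => [|i r IH].
  by apply: sgsf_ext (sgsf_cst X 0) => x _; rewrite big_nil.
by apply: sgsf_ext (sgsfD (sf i) IH) => x _; rewrite big_cons.
Qed.

Definition comp_dom n k (Om' : epsilon R -> set 'rV[R]_n) (G : epsilon R -> 'rV[R]_n -> 'rV[R]_k)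
    (Om : epsilon R -> set 'rV[R]_k) e : set 'rV[R]_n := [set x | Om' e x /\ Om e (G e x)].

Lemma open_comp_dom n k (X : set 'rV[gring rho]_n) (Y : set 'rV[gring rho]_k) g Om' G f Om F :
  gsf_net X Y g Om' G -> snet Y f Om F ->
  (forall e, open (comp_dom Om' G Om e)) /\ X `<=` strong_set (comp_dom Om' G Om).
Proof.
move=> gP [oOm sOm _ _]; have [oOm' smG sOm' gr] := gP; split.
  move=> e; rewrite openE => x [Om'x OmGx].
  have cG : {for x, continuous (G e)} by have [] := smG e [::] x Om'x.
  have h : \forall y \near x, Om e (G e y) by apply: cG; exact: near_open.
  by apply: filterS2 (near_open (oOm' e) Om'x) h => y; split.
move=> x Xx x_ xr; have [Yg r _] := gr _ _ Xx xr.
by apply: filterS2 (sOm' _ Xx _ xr) (sOm _ Yg _ r) => e; split.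
Qed.

Lemma snet_comp n k (X : set 'rV[gring rho]_n) (Y : set 'rV[gring rho]_k) g Om' G f Om F :
  gsf_net X Y g Om' G -> snet Y f Om F ->
  snet X (fun x => f (g x)) (comp_dom Om' G Om) (fun e x => F e (G e x)).
Proof.
move=> gP sF; have [oC sC] := open_comp_dom gP sF.
have [oOm sOm tF rF] := sF; have [_ _ _ gr] := gP; have /gsf_netP[_ _ _ gi] := gP.
split; [exact: oC | exact: sC | |].
  move=> m; apply: (tame_comp oC sC oOm _ _ _ (tF m)).
  - by move=> e x [].
  - by move=> x_ x Xx xr; have [Yg r _] := gr _ _ Xx xr; exists (g x).
  move=> i; have [_ _ tG _] := gi i.
  by apply: tame_sub (tG m) => // e x [].
by move=> x_ x Xx xr; have [Yg r _] := gr _ _ Xx xr; exact: rF.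
Qed.

Lemma sgsf_comp n k (X : set 'rV[gring rho]_n) (Y : set 'rV[gring rho]_k) g f :
  gsf X Y g -> sgsf Y f -> sgsf X (fun x => f (g x)).
Proof. by move=> [? [? gP]] [? [? sF]]; do 2 eexists; exact: snet_comp gP sF. Qed.

(** * Derivatives of vector valued functions *)

Definition vder n k (X : set 'rV[gring rho]_n) (f : 'rV[gring rho]_n -> 'rV[gring rho]_k)
    (j : 'I_n) (f' : 'rV[gring rho]_n -> 'rV[gring rho]_k) : Prop :=
  forall i, is_gder X (fun x => f x 0 i) j (fun x => f' x 0 i).

Lemma vder_unique n k (X : set 'rV[gring rho]_n) (f g g' : _ -> 'rV[gring rho]_k) j x :
  sharp_open X -> vder X f j g -> vder X f j g' -> X x -> g x = g' x.
Proof.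
by move=> oX fg fg' Xx; apply/rowP => i; exact: (gder_unique oX (fg i) (fg' i) Xx).
Qed.

Lemma vder_ext n k (X : set 'rV[gring rho]_n) (f f' : _ -> 'rV[gring rho]_k) g g' j :
  {in X, f =1 f'} -> {in X, g =1 g'} -> vder X f j g -> vder X f' j g'.
Proof.
by move=> ff gg fg i; apply: gder_ext (fg i) => x Xx; rewrite ?ff ?gg.
Qed.

Lemma pdiff1_coord n k (h : 'rV[R]_n -> 'rV[R]_k) (U : set 'rV[R]_n) j x i :
  smooth_on U h -> U x -> pdiff [:: j] h x 0 i = 'D_(delta_mx 0 j) (fun z => h z 0 i) x.
Proof.
by move=> sm Ux; rewrite /= derive_mx ?mxE //; have [_ d] := sm [::] x Ux; exact: d.
Qed.

Lemma interior_subset n (X D : set 'rV[gring rho]_n) x : sharp_open D -> D `<=` X ->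
  D x -> sharp_interior X x.
Proof. by move=> oD DX /oD[r r0 rD]; exists r => //; exact: subset_trans rD DX. Qed.

(** Interior points exclude the boundary clause of [is_pder], and the derivative of
    any net provides a value for the interior one. *)
Lemma is_pder_pder n k (X D : set 'rV[gring rho]_n) (Y : set 'rV[gring rho]_k) f j x :
  gsf X Y f -> sharp_open D -> D `<=` X -> D x -> is_pder X f j x (pder X f j x).
Proof.
move=> [Om [f_ fP]] oD DX Dx; have /gsf_netP[oOm sOm _ fi] := fP.
have [_ smOm _ _] := fP.
rewrite /pder; apply: (@xgetPex _ 0 (is_pder X f j x)).
have H (i : 'I_k) : exists g', snet D g' Om (fun e => 'D_(delta_mx 0 j) (fun z => f_ e z 0 i)).
  exact: (snet_gder j oD (snet_restrict DX (fi i))).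
have /choice[g' gP'] := H.
exists (\row_i g' i x); left; split; first exact: interior_subset Dx.
have xr := mrepresents_mnet x.
exists Om, f_, (mnet x); split; [by apply/gsf_netP; split | exact: xr |].
apply: mrepresents_row => i; rewrite mxE; have [_ _ _ r'] := gP' i.
apply: represents_near (r' _ _ Dx xr); apply: filterS (sOm _ (DX _ Dx) _ xr) => e Ome.
by rewrite (pdiff1_coord _ _ (smOm e)).
Qed.

Lemma pder_vder n k (X D : set 'rV[gring rho]_n) (Y : set 'rV[gring rho]_k) f j :
  gsf X Y f -> sharp_open D -> D `<=` X -> vder D f j (pder X f j).
Proof.
move=> fgsf oD DX i; have [Om [f_ fP]] := fgsf.
have /gsf_netP[oOm sOm _ fi] := fP.
exists Om, (fun e x => f_ e x 0 i); split; first exact: snet_restrict (fi i).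
have [oi si ti _] := snet_restrict DX (fi i).
split; [exact: oi | exact: si | by move=> m; exact: tame_derive (ti m.+1) |].
move=> x_ x Dx xr; have xint := interior_subset oD DX Dx.
have [|[_ _ nint _ _]] := is_pder_pder j fgsf oD DX Dx; last by case: (nint xint).
move=> [_ [Om' [f'_ [x'_ [f'P x'r dr]]]]].
have /gsf_netP[_ sOm' _ /(_ i) f'i] := f'P; have [_ sm' _ _] := f'P.
apply: (derive_represents f'i (fi i) xint x'r xr).
apply: represents_near (dr 0 i).
by apply: filterS (sOm' _ (DX _ Dx) _ x'r) => e Ome; rewrite (pdiff1_coord _ _ (sm' e)).
Qed.

Lemma vder_is_pder n k (X : set 'rV[gring rho]_n) (Y : set 'rV[gring rho]_k) f f' j x :
  sharp_open X -> gsf X Y f -> vder X f j f' -> X x -> is_pder X f j x (f' x).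
Proof.
move=> oX fP ff' Xx; have XX : X `<=` X by [].
rewrite (vder_unique oX ff' (pder_vder j fP oX XX) Xx).
exact: (is_pder_pder j fP oX XX).
Qed.

(** By [gder_net] the derivatives of [f] and [g] may be computed from the nets that
    define the composite. *)
Lemma gder_comp n k (X : set 'rV[gring rho]_n) (Y : set 'rV[gring rho]_k) f f' g g' j :
  sharp_open X -> sharp_open Y -> gsf X Y g -> sgsf Y f ->
  (forall i, is_gder Y f i (f' i)) -> vder X g j g' ->
  is_gder X (fun x => f (g x)) j (fun x => \sum_i f' i (g x) * g' x 0 i).
Proof.
move=> oX oY [Om' [G gP]] [Om [F sF]] df dg.
have [oC sC] := open_comp_dom gP sF; have [oOm _ tF _] := sF.
have /gsf_netP[oOm' _ _ gi] := gP.
exists (comp_dom Om' G Om), (fun e x => F e (G e x)); split; first exact: snet_comp gP sF.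
have sFi i := gder_net oY (df i) sF.
have sGi i : snet X (fun x => g' x 0 i) (comp_dom Om' G Om)
    (fun e => 'D_(delta_mx 0 j) (fun z => G e z 0 i)).
  by apply: (snet_sub oC sC _ _ (gder_net oX (dg i) (gi i))) => // e x [].
apply: (snet_eq (F := fun e x => \sum_i 'D_(delta_mx 0 i) (F e) (G e x) *
    'D_(delta_mx 0 j) (fun z => G e z 0 i) x)); last first.
  by apply: snet_sum => // i; apply: snetM (sGi i); exact: snet_comp gP (sFi i).
move=> e x [Om'x OmGx].
have [||| _ ->] // := @is_derive_chain R n k (F e) (G e) x (delta_mx 0 j).
- by move=> i; have [_ _ tG _] := gi i; exact: tame_derivable (tG 1%N) Om'x.
- apply: filterS (near_open (oOm e) OmGx) => y Omy i.
  exact: tame_derivable (tF 1%N) Omy.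
- by move=> i; exact: tame_continuous (tame_derive i (tF 1%N)) OmGx.
Qed.

End VectorFunctions.

(** * Functions on products of sharply open sets *)

Section Products.
Context {R : realType} {rho : gauge R}.
Local Notation vec n := 'rV[gring rho]_n.
Implicit Types (m n k : nat).

Lemma gsf_comp m n k (X : set (vec m)) (Y : set (vec n)) (Z : set (vec k)) g f :
  gsf X Y g -> gsf Y Z f -> gsf X Z (fun x => f (g x)).
Proof.
move=> gP fP; apply: gsf_row => [x Xx|i].
  exact: gsf_val fP (gsf_val gP Xx).
exact: (sgsf_comp (f := fun y => f y 0 i) gP (gsf_sgsf i fP)).
Qed.

Lemma gsf_row_mx m n k (X : set (vec m)) (Y : set (vec n)) (Z : set (vec k)) a b :
  gsf X Y a -> gsf X Z b -> gsf X (prodv Y Z) (fun x => row_mx (a x) (b x)).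
Proof.
move=> aP bP; apply: gsf_row => [x Xx|i].
  by rewrite /prodv /= row_mxKl row_mxKr; split; [exact: gsf_val aP Xx | exact: gsf_val bP Xx].
case: (split_ordP i) => i' ->.
  by apply: sgsf_ext (gsf_sgsf i' aP) => x _; rewrite row_mxEl.
by apply: sgsf_ext (gsf_sgsf i' bP) => x _; rewrite row_mxEr.
Qed.

Lemma gsf_lsubmx m n (X : set (vec m)) (Y : set (vec n)) : gsf (prodv X Y) X lsubmx.
Proof.
apply: gsf_row => [x [] //|i].
by apply: sgsf_ext (sgsf_coord _ (lshift n i)) => x _; rewrite mxE.
Qed.

Lemma gsf_rsubmx m n (X : set (vec m)) (Y : set (vec n)) : gsf (prodv X Y) Y rsubmx.
Proof.
apply: gsf_row => [x [] //|i].
by apply: sgsf_ext (sgsf_coord _ (rshift m i)) => x _; rewrite mxE.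
Qed.

Lemma gsf_cst m n (X : set (vec m)) (Y : set (vec n)) c : Y c -> gsf X Y (fun=> c).
Proof. by move=> Yc; apply: gsf_row => // i; exact: sgsf_cst. Qed.

Lemma gsf_id m (X : set (vec m)) : gsf X X id.
Proof. by apply: gsf_row => // i; exact: sgsf_coord. Qed.

Lemma gsf_setT m n (X : set (vec m)) (Y : set (vec n)) f : gsf X Y f -> gsf X setT f.
Proof. exact: gsf_weaken. Qed.

Lemma vder_gsf m n (X : set (vec m)) (f f' : _ -> vec n) j : vder X f j f' -> gsf X setT f.
Proof. by move=> ff'; apply: gsf_row => // i; exact: gder_sgsf (ff' i). Qed.

Lemma vder_gsf' m n (X : set (vec m)) (f f' : _ -> vec n) j : vder X f j f' -> gsf X setT f'.
Proof. by move=> ff'; apply: gsf_row => // i; exact: gder_sgsf' (ff' i). Qed.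

Lemma vder_pder m n (X : set (vec m)) (Y : set (vec n)) f j :
  sharp_open X -> gsf X Y f -> vder X f j (pder X f j).
Proof. by move=> oX fP; exact: pder_vder fP oX _. Qed.

Lemma vder_cst m n (X : set (vec m)) (c : vec n) j : vder X (fun=> c) j (fun=> 0).
Proof. by move=> i; apply: gder_ext (gder_cst X (c 0 i) j) => x _; rewrite // mxE. Qed.

Lemma vder_id m (X : set (vec m)) j : vder X id j (fun=> delta_mx 0 j).
Proof. by move=> i; apply: gder_ext (gder_coord X i j) => x _ //; rewrite mxE eqxx. Qed.

Lemma vder_lsubmx m n (X : set (vec (m + n))) j :
  vder X lsubmx j (fun=> lsubmx (delta_mx 0 j)).
Proof.
by move=> i; apply: gder_ext (gder_coord X (lshift n i) j) => x _; rewrite !mxE ?eqxx.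
Qed.

Lemma vder_rsubmx m n (X : set (vec (m + n))) j :
  vder X rsubmx j (fun=> rsubmx (delta_mx 0 j)).
Proof.
by move=> i; apply: gder_ext (gder_coord X (rshift m i) j) => x _; rewrite !mxE ?eqxx.
Qed.

Lemma vder_row_mx m n k (X : set (vec m)) (a a' : _ -> vec n) (b b' : _ -> vec k) j :
  vder X a j a' -> vder X b j b' ->
  vder X (fun x => row_mx (a x) (b x)) j (fun x => row_mx (a' x) (b' x)).
Proof.
move=> aP bP i; case: (split_ordP i) => i' ->.
  by apply: gder_ext (aP i') => x _; rewrite row_mxEl.
by apply: gder_ext (bP i') => x _; rewrite row_mxEr.
Qed.

Lemma vder_comp m n k (X : set (vec m)) (Y : set (vec n)) (f : _ -> vec k) f' g g' j :
  sharp_open X -> sharp_open Y -> gsf X Y g -> gsf Y setT f ->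
  (forall i, vder Y f i (f' i)) -> vder X g j g' ->
  vder X (fun x => f (g x)) j (fun x => \sum_i g' x 0 i *: f' i (g x)).
Proof.
move=> oX oY gP fP df dg i.
apply: gder_ext (gder_comp (f := fun y => f y 0 i) (f' := fun i' y => f' i' y 0 i)
  oX oY gP (gsf_sgsf i fP) (fun i' => df i' i) dg) => x _ //.
by rewrite summxE; apply: eq_bigr => i' _; rewrite mxE mulrC.
Qed.

(** Only the [i]-th term of the chain rule survives. *)
Lemma vder_comp_axis m n k (X : set (vec m)) (Y : set (vec n)) (f : _ -> vec k) f' g j i :
  sharp_open X -> sharp_open Y -> gsf X Y g -> vder Y f i f' ->
  vder X g j (fun=> delta_mx 0 i) -> vder X (fun x => f (g x)) j (fun x => f' (g x)).
Proof.
move=> oX oY gP ff' dg; have fP := vder_gsf ff'.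
apply: vder_ext (vder_comp oX oY gP fP (fun i => vder_pder i oY fP) dg) => // x.
rewrite inE => Xx; rewrite (bigD1 i) //= mxE !eqxx scale1r big1 ?addr0.
  exact: (vder_unique oY (vder_pder i oY fP) ff' (gsf_val gP Xx)).
by move=> i' /negPf ii; rewrite mxE eqxx ii scale0r.
Qed.

Lemma vder_comp_stationary m n k (X : set (vec m)) (Y : set (vec n)) (f : _ -> vec k) g j :
  sharp_open X -> sharp_open Y -> gsf X Y g -> gsf Y setT f ->
  vder X g j (fun=> 0) -> vder X (fun x => f (g x)) j (fun=> 0).
Proof.
move=> oX oY gP fP dg.
apply: vder_ext (vder_comp oX oY gP fP (fun i => vder_pder i oY fP) dg) => // x _.
by rewrite big1 // => i _; rewrite mxE scale0r.
Qed.

Lemma delta_lshift (A : pzRingType) m n (i : 'I_m) :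
  delta_mx 0 (lshift n i) = row_mx (delta_mx 0 i) 0 :> 'rV[A]_(m + n).
Proof.
apply/rowP => k; rewrite mxE; case: (split_ordP k) => k' ->.
  by rewrite row_mxEl mxE (inj_eq (@lshift_inj _ _)).
by rewrite row_mxEr mxE eqxx eq_rlshift.
Qed.

Lemma delta_rshift (A : pzRingType) m n (i : 'I_n) :
  delta_mx 0 (rshift m i) = row_mx 0 (delta_mx 0 i) :> 'rV[A]_(m + n).
Proof.
apply/rowP => k; rewrite mxE; case: (split_ordP k) => k' ->.
  by rewrite row_mxEl mxE eqxx eq_lrshift.
by rewrite row_mxEr mxE (inj_eq (@rshift_inj _ _)).
Qed.

Context {p m n : nat} {P : set (vec p)} {T : set (vec m)}.
Hypotheses (oP : sharp_open P) (oT : sharp_open T).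
Let W := prodv P T.
Let oW : sharp_open W := sharp_open_prodv oP oT.

Lemma vder_slice (f f' : _ -> vec n) s j : P s -> vder W f (rshift p j) f' ->
  vder T (fun t => f (row_mx s t)) j (fun t => f' (row_mx s t)).
Proof.
move=> Ps ff'; apply: (vder_comp_axis (Y := W) (i := rshift p j)) => //.
  by apply: gsf_row_mx; [exact: gsf_cst | exact: gsf_id].
rewrite delta_rshift; exact: vder_row_mx (vder_cst _ _ _) (vder_id _ _).
Qed.

(** A function of [(s, t)] that does not depend on [s] is its own composition
    with the projection [(s, t) |-> (s0, t)]. *)
Lemma vder_constant (f f' : _ -> vec n) s0 i x : P s0 ->
  (forall x, W x -> f x = f (row_mx s0 (rsubmx x))) ->
  vder W f (lshift m i) f' -> W x -> f' x = 0.
Proof.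
move=> Ps fc ff' Wx; apply: (vder_unique oW ff' _ Wx).
have gP : gsf W W (fun x => row_mx s0 (rsubmx x)).
  by apply: gsf_row_mx; [exact: gsf_cst | exact: gsf_rsubmx].
have dg : vder W (fun x => row_mx s0 (rsubmx x)) (lshift m i) (fun=> 0).
  have := vder_row_mx (vder_cst W s0 (lshift m i)) (vder_rsubmx W (lshift m i)).
  by rewrite delta_lshift row_mxKr row_mx0.
apply: vder_ext (vder_comp_stationary oW oW gP (vder_gsf ff') dg) => // y.
by rewrite inE => /fc ->.
Qed.

(** Transport of the curve [c] by a family [psi] of transformations: at fixed [t],
    the parameter [s] enters only through the first argument of [psi]. *)
Section Family.
Context {k : nat} {D : set (vec k)} (oD : sharp_open D).
Context (psi : vec (p + k) -> vec n) (c : vec m -> vec k).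
Hypotheses (psiP : gsf (prodv P D) setT psi) (cP : gsf T D c).

Definition carry (x : vec (p + m)) : vec (p + k) := row_mx (lsubmx x) (c (rsubmx x)).

Lemma gsf_carry : gsf W (prodv P D) carry.
Proof.
apply: gsf_row_mx; first exact: gsf_lsubmx.
exact: (gsf_comp (gsf_rsubmx P T) cP).
Qed.

Lemma vder_carry i : vder W (fun x => psi (carry x)) (lshift m i)
  (fun x => pder (prodv P D) psi (lshift k i) (carry x)).
Proof.
have oPD := sharp_open_prodv oP oD.
apply: (vder_comp_axis (i := lshift k i)) gsf_carry (vder_pder _ oPD psiP) _ => //.
have d2 : vder W (fun x => c (rsubmx x)) (lshift m i) (fun=> 0).
  apply: (vder_comp_stationary oW oT (gsf_rsubmx P T) (gsf_setT cP)).
  by have := vder_rsubmx W (lshift m i); rewrite delta_lshift row_mxKr.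
have := vder_row_mx (vder_lsubmx W (lshift m i)) d2.
by rewrite !delta_lshift row_mxKl.
Qed.

End Family.
End Products.

(** * The Hamiltonian along a family of curves *)

Section DotProduct.
Context {R : realType} {rho : gauge R}.
Local Notation vec n := 'rV[gring rho]_n.

Lemma dot_sym (A : comPzRingType) n (a b : 'rV[A]_n) : a *m b^T = b *m a^T.
Proof.
by apply/matrixP => i j; rewrite !mxE !ord1; apply: eq_bigr => k _; rewrite !mxE mulrC.
Qed.

Lemma tr_mx11 (A : Type) (a : 'M[A]_1) : a^T = a.
Proof. by apply/matrixP => i j; rewrite mxE !ord1. Qed.

Lemma mulmx11C (A : comPzRingType) (a b : 'M[A]_1) : a *m b = b *m a.
Proof. by rewrite -{1}(tr_mx11 b) dot_sym tr_mx11. Qed.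

Lemma vder_dot n k (X : set (vec n)) (a a' b b' : _ -> vec k) j :
  vder X a j a' -> vder X b j b' ->
  vder X (fun x => a x *m (b x)^T) j (fun x => a' x *m (b x)^T + a x *m (b' x)^T).
Proof.
move=> aP bP i; rewrite ord1; apply: gder_ext (gder_sum _ (fun i => gderM (aP i) (bP i))) => x _ /=.
  by rewrite mxE; apply: eq_bigr => i' _; rewrite mxE.
rewrite !mxE -big_split; apply: eq_bigr => i' _ /=.
by rewrite !mxE addrC mulrC [X in _ + X]mulrC mulrC [X in _ + X]mulrC.
Qed.

Lemma vder_mulmx11 n (X : set (vec n)) (a a' b b' : _ -> vec 1) j :
  vder X a j a' -> vder X b j b' ->
  vder X (fun x => a x *m b x) j (fun x => a' x *m b x + a x *m b' x).
Proof.
by move=> aP bP; apply: vder_ext (vder_dot aP bP) => x _; rewrite !tr_mx11.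
Qed.

Lemma vderB n k (X : set (vec n)) (a a' b b' : _ -> vec k) j :
  vder X a j a' -> vder X b j b' ->
  vder X (fun x => a x - b x) j (fun x => a' x - b' x).
Proof.
by move=> aP bP i; apply: gder_ext (gderD (aP i) (gderN (bP i))) => x _; rewrite !mxE.
Qed.

Lemma vder_schwarz n k (X : set (vec n)) (f fi fj fij : _ -> vec k) i j : sharp_open X ->
  vder X f i fi -> vder X f j fj -> vder X fi j fij -> vder X fj i fij.
Proof. by move=> oX dfi dfj dfij a; exact: (gder_schwarz oX (dfi a) (dfj a) (dfij a)). Qed.

Lemma gsf_hamiltonian d l (X : set (vec (1 + d + l))) (A : set (vec d)) L phi :
  gsf X setT L -> gsf X setT phi ->
  gsf (prodv X A) setT (hamiltonian L phi).
Proof.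
move=> LP phiP; apply: gsf_row => // i; rewrite ord1.
have lP (f : vec (1 + d + l) -> gring rho) : sgsf X f ->
    sgsf (prodv X A) (fun x => f (lsubmx x)).
  by move=> fP; exact: (sgsf_comp (gsf_lsubmx X A) fP).
apply: sgsf_ext (sgsfD (lP _ (gsf_sgsf 0 LP)) (sgsf_sum _ (fun i : 'I_d =>
  sgsfM (gsf_sgsf i (gsf_rsubmx X A)) (lP _ (gsf_sgsf i phiP))))) => x _.
by rewrite /hamiltonian !mxE; congr (_ + _); apply: eq_bigr => k _; rewrite !mxE.
Qed.

(** The chain rule for the Hamiltonian along a motion of velocity [(a, b, c, e)]:
    the canonical equations supply its gradient [F] in [p], [q] and [u], and leave
    only the partial derivative in [t] undetermined. *)
Lemma phase_gradient (A : comPzRingType) d l (a : 'rV[A]_1) (b e q' p' : 'rV[A]_d) (c : 'rV[A]_l)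
    (F : 'I_(1 + d + l + d) -> 'rV[A]_1) :
  (forall i, F (rshift (1 + d + l) i) = (q' 0 i)%:M) ->
  (forall i, F (lshift d (q_idx i)) = - (p' 0 i)%:M) ->
  (forall i, F (lshift d (u_idx i)) = 0) ->
  \sum_i (row_mx (row_mx (row_mx a b) c) e) 0 i *: F i =
  a *m F (lshift d (lshift l (lshift d ord0))) - b *m p'^T + e *m q'^T.
Proof.
move=> Fp Fq Fu; rewrite !big_split_ord /= big_ord1 !row_mxEl.
rewrite [X in _ + X + _]big1 => [|i _]; last by rewrite Fu scaler0.
rewrite addr0; congr (_ + _ + _).
- by rewrite {2}(mx11_scalar a) mul_scalar_mx.
- apply/matrixP => i j; rewrite !ord1 summxE !mxE -sumrN; apply: eq_bigr => k _.
  by rewrite !row_mxEl row_mxEr Fq !mxE mulr1n mulrN.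
apply/matrixP => i j; rewrite !ord1 summxE !mxE; apply: eq_bigr => k _.
by rewrite row_mxEr Fp !mxE mulr1n.
Qed.

(** With [F] the gradient of the Hamiltonian, the invariance differentiated in the
    group parameter becomes the vanishing derivative of the Noether quantity: the
    canonical equations remove the terms in [vs], and [p'] and [q'] cancel each
    other in the derivative of the Hamiltonian along the extremal. *)
Lemma noether_identity (A : comPzRingType) d l (h ts tts : 'rV[A]_1)
    (Ss Sts vs p q' p' : 'rV[A]_d) (us u' : 'rV[A]_l) (F : 'I_(1 + d + l + d) -> 'rV[A]_1) :
  (forall i, F (rshift (1 + d + l) i) = (q' 0 i)%:M) ->
  (forall i, F (lshift d (q_idx i)) = - (p' 0 i)%:M) ->
  (forall i, F (lshift d (u_idx i)) = 0) ->
  (\sum_i (row_mx (row_mx (row_mx ts Ss) us) vs) 0 i *: F i) *m 1%:M + h *m tts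
    - (vs *m q'^T + p *m Sts^T) = 0 ->
  (\sum_i (row_mx (row_mx (row_mx 1%:M q') u') p') 0 i *: F i) *m ts + h *m tts
    - (p' *m Ss^T + p *m Sts^T) = 0.
Proof.
move=> Fp Fq Fu; rewrite !(phase_gradient _ _ _ _ Fp Fq Fu) mulmx1 mul1mx.
rewrite (dot_sym p' q') subrK (dot_sym p' Ss) (mulmx11C _ ts).
move: (ts *m _) (Ss *m _) (vs *m _) (h *m _) (p *m _) => a b c e f <-.
by rewrite !opprD !addrA; congr (_ - _); rewrite [in RHS]addrAC addrK addrAC.
Qed.

End DotProduct.

Theorem theorem70 (R : realType) (rho : gauge R) (d l : nat)
  (t1 t2 : gring rho) (ht : glt t1 t2)
  (H : set 'rV[gring rho]_d) (K : set 'rV[gring rho]_l)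
  (Hfc : functionally_compact H) (Hsolid : solid H)
  (Kfc : functionally_compact K) (Ksolid : solid K)
  (L : 'rV[gring rho]_(1 + d + l) -> 'rV[gring rho]_1)
  (hL : gsf (prodv (prodv (gitv t1 t2) H) K) setT L)
  (phi : 'rV[gring rho]_(1 + d + l) -> 'rV[gring rho]_d)
  (hphi : gsf (prodv (prodv (gitv t1 t2) H) K) setT phi)
  (q1 : 'rV[gring rho]_d) (r : gring rho) (hr : glt 0 r)
  (hball : gcball q1 r `<=` H)
  (MK LK : gring rho)
  (hMK : is_gmax (prodv (prodv (gitv t1 t2) (gcball q1 r)) K)
           (fun x => vnorm (phi x)) MK)
  (hLK : is_gmax (prodv (prodv (gitv t1 t2) (gcball q1 r)) K)
           (fun x => vnorm (gjacobian (prodv (prodv (gitv t1 t2) H) K) phi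
                              (fun i : 'I_d => q_idx i) x)) LK)
  (hMKr : gle ((t2 - t1) * MK) r)
  (hLK0 : sharp_cvg0 (fun n : nat => (t2 - t1) ^+ n * LK ^+ n))
  (P T' : set 'rV[gring rho]_1) (S' : set 'rV[gring rho]_d)
  (U' : set 'rV[gring rho]_l) (A' : set 'rV[gring rho]_d)
  (tau : 'rV[gring rho]_1 -> 'rV[gring rho]_1 -> 'rV[gring rho]_1)
  (sigma : 'rV[gring rho]_1 -> 'rV[gring rho]_d -> 'rV[gring rho]_d)
  (upsilon : 'rV[gring rho]_1 -> 'rV[gring rho]_l -> 'rV[gring rho]_l)
  (varpi : 'rV[gring rho]_1 -> 'rV[gring rho]_d -> 'rV[gring rho]_d)
  (hT' : T' `<=` gitv t1 t2) (hS' : S' `<=` H) (hU' : U' `<=` K)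
  (htau : one_parameter_group P T' tau)
  (hsigma : one_parameter_group P S' sigma)
  (hupsilon : one_parameter_group P U' upsilon)
  (hvarpi : one_parameter_group P A' varpi)
  (hinv : augmented_functional_invariant t1 t2 H K L phi q1 r P T' S' U' A'
            tau sigma upsilon varpi) :
  constant_of_motion t1 t2 H K L phi q1 r T' S' U' A'
    (noether_quantity L phi P T' S' tau sigma).
Proof.
move=> q u p ext t0 Tt0.
have [[[[qgsf _] ugsf pgsf] canonical _ _] within] := ext.
have [[oP P0 oT] tau2P tau_diffeo tau0 _] := htau.
have [[_ _ oS] sigma2P _ sigma0 _] := hsigma.
have [[_ _ oU] upsilon2P _ upsilon0 _] := hupsilon.
have [[_ _ oA] varpi2P _ varpi0 _] := hvarpi.
have qP : gsf T' S' q.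
  by apply: gsf_weaken qgsf => // t /within[].
have uP : gsf T' U' u.
  by apply: gsf_weaken ugsf => // t /within[].
have pP : gsf T' A' p.
  by apply: gsf_weaken pgsf => // t /within[].
pose W := prodv P T'; have oW : sharp_open W := sharp_open_prodv oP oT.
pose ds : 'I_(1 + 1) := ds_idx 1; pose dt : 'I_(1 + 1) := dt_idx.
(* [T'] is open, so its points are interior to [t1, t2] and the derivatives in
   the canonical equations are those of the restrictions to [T'] *)
pose q' := pder (gitv t1 t2) q ord0; pose p' := pder (gitv t1 t2) p ord0.
have dq : vder T' q ord0 q' := pder_vder _ qgsf oT hT'.
have dp : vder T' p ord0 p' := pder_vder _ pgsf oT hT'.
have du := vder_pder ord0 oT uP.
(* the transformed extremal is studied on P x T'; the t-derivatives enter the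
   invariance, the s-derivatives the Noether quantity, and the mixed derivatives
   [tauts], [Sgts] serve both by symmetry *)
pose tau2 := uncurry_mx tau.
pose Sg x := uncurry_mx sigma (carry q x).
pose Up x := uncurry_mx upsilon (carry u x).
pose Vp x := uncurry_mx varpi (carry p x).
have SgP : gsf W S' Sg := gsf_comp (gsf_carry qP) sigma2P.
have UpP : gsf W U' Up := gsf_comp (gsf_carry uP) upsilon2P.
have VpP : gsf W A' Vp := gsf_comp (gsf_carry pP) varpi2P.
pose taus := pder W tau2 ds; pose taut := pder W tau2 dt.
have dtaus : vder W tau2 ds taus := vder_pder ds oW tau2P.
have dtaut : vder W tau2 dt taut := vder_pder dt oW tau2P.
pose tauts := pder W taut ds.
have dtauts : vder W taut ds tauts := vder_pder ds oW (vder_gsf' dtaut).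
have dtaust : vder W taus dt tauts := vder_schwarz oW dtaut dtaus dtauts.
pose Sgs x := pder (prodv P S') (uncurry_mx sigma) (ds_idx d) (carry q x).
have dSgs : vder W Sg ds Sgs := vder_carry oP oT oS (gsf_setT sigma2P) qP ord0.
pose Sgt := pder W Sg dt; pose Sgts := pder W Sgt ds.
have dSgt : vder W Sg dt Sgt := vder_pder dt oW SgP.
have dSgts : vder W Sgt ds Sgts := vder_pder ds oW (vder_gsf' dSgt).
have dSgst : vder W Sgs dt Sgts := vder_schwarz oW dSgt dSgs dSgts.
have dUps := vder_pder ds oW UpP; have dVps := vder_pder ds oW VpP.
(* the extremal and its transforms stay in the open set [D0] of phase points, away
   from the boundary of [H] and [K] *)
pose HD : set 'rV[gring rho]_(1 + d + l + d) := hamiltonian_dom t1 t2 H K.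
pose ham := hamiltonian L phi; pose dH i := pder HD ham i.
pose D0 := prodv (prodv (prodv T' S') U') A'.
have oD0 : sharp_open D0 by do 3 apply: sharp_open_prodv => //.
have D0HD : D0 `<=` HD.
  rewrite /D0 /HD /hamiltonian_dom /prodv => x /= [[[/hT' xT /hS' xS] /hU' xU] _].
  by split.
have hamP : gsf HD setT ham := gsf_hamiltonian setT hL hphi.
have hamP0 : gsf D0 setT ham by apply: gsf_weaken hamP.
have dham i : vder D0 ham i (dH i) := pder_vder i hamP oD0 D0HD.
have gradient t : T' t -> let z := phase_point t (q t) (u t) (p t) in
    [/\ forall i, dH (rshift (1 + d + l) i) z = (q' t 0 i)%:M,
        forall i, dH (lshift d (q_idx i)) z = - (p' t 0 i)%:M &
        forall i, dH (lshift d (u_idx i)) z = 0].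
  move=> Tt z; have [eq_q eq_p eq_u] := canonical _ (hT' _ Tt).
  split=> i; rewrite [LHS]mx11_scalar.
  - by congr (_%:M); move/rowP/(_ i): eq_q; rewrite [RHS]mxE => <-.
  - rewrite -raddfN; congr (_%:M); move/rowP/(_ i): eq_p.
    by rewrite !mxE => ->; rewrite opprK.
  - by move/rowP/(_ i): eq_u; rewrite !mxE => ->; rewrite raddf0.
pose x0 t : 'rV[gring rho]_(1 + 1) := row_mx 0 t.
have Wx0 t : T' t -> W (x0 t) by move=> Tt; rewrite /W /prodv /= row_mxKl row_mxKr.
have tau20 t : T' t -> tau2 (x0 t) = t.
  by move=> Tt; rewrite /tau2 /uncurry_mx row_mxKl row_mxKr tau0.
have carryE k (c : 'rV[gring rho]_1 -> 'rV[gring rho]_k) s t : carry c (row_mx s t) = row_mx s (c t).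
  by rewrite /carry row_mxKl row_mxKr.
have Sg0 t : T' t -> Sg (x0 t) = q t.
  move=> Tt; rewrite /Sg carryE /uncurry_mx row_mxKl row_mxKr sigma0 //.
  exact: gsf_val qP Tt.
have Up0 t : T' t -> Up (x0 t) = u t.
  move=> Tt; rewrite /Up carryE /uncurry_mx row_mxKl row_mxKr upsilon0 //.
  exact: gsf_val uP Tt.
have Vp0 t : T' t -> Vp (x0 t) = p t.
  move=> Tt; rewrite /Vp carryE /uncurry_mx row_mxKl row_mxKr varpi0 //.
  exact: gsf_val pP Tt.
have slice n (f f' : _ -> 'rV[gring rho]_n) s : P s -> vder W f dt f' ->
    vder T' (fun t => f (row_mx s t)) ord0 (fun t => f' (row_mx s t)).
  exact: vder_slice.
have delta1 : delta_mx 0 ord0 = 1%:M :> 'rV[gring rho]_1.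
  by apply/rowP => i; rewrite !mxE !ord1.
have taut0 t : T' t -> taut (x0 t) = 1%:M.
  have dtau : vder T' id ord0 (fun t => taut (x0 t)).
    by apply: vder_ext (slice _ _ _ _ P0 dtaut) => // t'; rewrite inE => /tau20.
  by move=> Tt; rewrite -delta1; exact: (vder_unique oT dtau (vder_id T' ord0) Tt).
have Sgt0 t : T' t -> Sgt (x0 t) = q' t.
  have dSg : vder T' q ord0 (fun t => Sgt (x0 t)).
    by apply: vder_ext (slice _ _ _ _ P0 dSgt) => // t'; rewrite inE => /Sg0.
  exact: (vder_unique oT dSg dq).
(* chain rule for [inv \o tau s = id] *)
have taut_unit s t : P s -> T' t -> taut (row_mx s t) 0 0 \is a GRing.unit.
  move=> Ps Tt; have [tauP [inv [invP invK _]]] := tau_diffeo s Ps.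
  have dtau : vder T' (tau s) ord0 (fun t => taut (row_mx s t)).
    apply: vder_ext (slice _ _ _ _ Ps dtaut) => // t' _.
    by rewrite /tau2 /uncurry_mx row_mxKl row_mxKr.
  have dcomp := vder_comp oT oT tauP (gsf_setT invP) (fun i => vder_pder i oT invP) dtau.
  have did : vder T' (fun t => inv (tau s t)) ord0 (fun=> delta_mx 0 ord0).
    by apply: vder_ext (vder_id T' ord0) => // t'; rewrite inE => /invK.
  have /rowP/(_ 0) := vder_unique oT dcomp did Tt.
  rewrite big_ord1 !mxE !eqxx => E; apply/unitrP.
  by exists (pder T' inv ord0 (tau s t) 0 0); rewrite mulrC.
(* the factor d_t tau of the integrand cancels the quotient in [dsigma_dtau]; by
   invariance the resulting function [G] does not depend on s *)
pose h x := ham (phase_point (tau2 x) (Sg x) (Up x) (Vp x)).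
pose G x := h x *m taut x - Vp x *m (Sgt x)^T.
have GE s t : P s -> T' t -> G (row_mx s t) =
    ham (phase_point t (q t) (u t) (p t)) - p t *m (q' t)^T.
  move=> Ps Tt; rewrite -(hinv _ _ _ ext _ _ Ps Tt) /dsigma_dtau.
  have -> : dtau_dt P T' tau s t = taut (row_mx s t) by [].
  have -> : pder T' (fun t => sigma s (q t)) ord0 t = Sgt (row_mx s t).
    have E : (fun t => Sg (row_mx s t)) = (fun t => sigma s (q t)).
      by apply/funext => t'; rewrite /Sg carryE /uncurry_mx row_mxKl row_mxKr.
    have := slice _ _ _ _ Ps dSgt; rewrite E => dS.
    exact: (vder_unique oT (vder_pder ord0 oT (vder_gsf dS)) dS Tt).
  rewrite /G /h /tau2 /Sg /Up /Vp !carryE /uncurry_mx !row_mxKl !row_mxKr.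
  rewrite mulmxBl; congr (_ - _).
  rewrite [X in _ = _ *m X](mx11_scalar (taut _)) mul_mx_scalar linearZ /= -scalemxAr scalerA.
  by rewrite divrr ?scale1r //; exact: taut_unit.
have Gconst x : W x -> G x = G (row_mx 0 (rsubmx x)).
  by rewrite /W /prodv => -[Ps Tt]; rewrite -{1}(hsubmxK x) !GE.
pose z x := phase_point (tau2 x) (Sg x) (Up x) (Vp x).
have zP : gsf W D0 z by do 3 apply: gsf_row_mx => //.
have dh : vder W h ds (fun x => \sum_i phase_point (taus x) (Sgs x)
    (pder W Up ds x) (pder W Vp ds x) 0 i *: dH i (z x)).
  by apply: (vder_comp oW oD0 zP hamP0 dham); do 3 apply: vder_row_mx => //.
have dG := vderB (vder_mulmx11 dh dtauts) (vder_dot dVps dSgts).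
have stationary x : W x -> (\sum_i phase_point (taus x) (Sgs x) (pder W Up ds x)
      (pder W Vp ds x) 0 i *: dH i (z x)) *m taut x + ham (z x) *m tauts x
    - (pder W Vp ds x *m (Sgt x)^T + Vp x *m (Sgts x)^T) = 0.
  exact: (vder_constant oP oT P0 Gconst dG).
pose y t := phase_point t (q t) (u t) (p t).
have yP : gsf T' D0 y by do 3 apply: gsf_row_mx => //; exact: gsf_id.
have dy : vder T' (fun t => ham (y t)) ord0 (fun t => \sum_i
    phase_point 1%:M (q' t) (pder T' u ord0 t) (p' t) 0 i *: dH i (y t)).
  apply: (vder_comp oT oD0 yP hamP0 dham); rewrite -delta1.
  by do 3 apply: vder_row_mx => //; exact: vder_id.
have dtaus0 : vder T' (fun t => taus (x0 t)) ord0 (fun t => tauts (x0 t)) := slice _ _ _ _ P0 dtaust.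
have dSgs0 : vder T' (fun t => Sgs (x0 t)) ord0 (fun t => Sgts (x0 t)) := slice _ _ _ _ P0 dSgst.
have dC := vderB (vder_mulmx11 dy dtaus0) (vder_dot dp dSgs0).
pose C t := noether_quantity L phi P T' S' tau sigma t (q t) (u t) (p t).
have {}dC : vder T' C ord0 (fun=> 0).
  apply: vder_ext dC => t; rewrite inE => Tt.
    by rewrite /C /noether_quantity /Sgs carryE.
  have [gp gq gu] := gradient t Tt.
  have zy : z (x0 t) = y t by rewrite /z tau20 ?Sg0 ?Up0 ?Vp0.
  have st := stationary _ (Wx0 t Tt).
  rewrite (taut0 t Tt) in st.
  rewrite (Sgt0 t Tt) in st.
  rewrite (Vp0 t Tt) in st.
  rewrite zy in st.
  exact: (noether_identity (F := fun i => dH i (y t)) _ gp gq gu st).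
exact: (vder_is_pder oT (vder_gsf dC) dC Tt0).
Qed.
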